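(* Let $\mathcal F=\{f_1,\dots,f_K\}$ be a set of $K\ge 4$ probability densities on $\mathcal X$ with respect to $\nu$ such that, for some constants $0<m\le M$, $m\le f_k(x)\le M$ for all $x\in\mathcal X$ and $k\in[K]$, and set $V=M/m$. Let $\boldsymbol X_1,\dots,\boldsymbol X_n$ be i.i.d. with density $f^*$ with respect to $\nu$, and let $f_{\hat{\boldsymbol\pi}}$ be the mixture density corresponding to the maximum likelihood estimator $\hat{\boldsymbol\pi}$ over the simplex $\mathbb B_+^K$. There are constants $c_1\le 32V^3$, $c_2\le 288M^2V^6$ and $c_3\le 128M^2V^6$ such that, for any $\delta\in(0,1/2)$, the following inequalities hold with probability at least $1-\delta$: $$\mathrm{KL}(f^*\|f_{\hat{\boldsymbol\pi}})\le \inf_{J\subset[K],\ \boldsymbol\pi\in\mathbb B_+^K}\Big\{\mathrm{KL}(f^*\|f_{\boldsymbol\pi})+c_1\Big(\frac{\log(K/\delta)}{n}\Big)^{1/2}\|\boldsymbol\pi_{J^c}\|_1+\frac{c_2|J|\log(K/\delta)}{n\,\kappa_{\hat{\boldsymbol\Sigma}_n}(J,3)}\Big\},$$ $$\mathrm{KL}(f^*\|f_{\hat{\boldsymbol\pi}})\le \inf_{J\subset[K]}\ \inf_{\boldsymbol\pi\in\mathbb B_+^K,\ \boldsymbol\pi_{J^c}=0}\Big\{\mathrm{KL}(f^*\|f_{\boldsymbol\pi})+\frac{c_3|J|\log(K/\delta)}{n\,\bar\kappa_{\hat{\boldsymbol\Sigma}_n}(J,1)}\Big\}.$$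
   Context: $[K]=\{1,\dots,K\}$. $\boldsymbol X_1,\dots,\boldsymbol X_n$ are independent random vectors in $\mathcal X$ with common distribution $P^*$, which has density $f^*$ with respect to a reference measure $\nu$; $f^*$ need not be a mixture of the $f_k$. The simplex is $\mathbb B_+^K=\{\boldsymbol\pi\in[0,1]^K:\sum_{j=1}^K\pi_j=1\}$, and $f_{\boldsymbol\pi}=\sum_{j=1}^K\pi_jf_j$. The maximum likelihood estimator is $\hat{\boldsymbol\pi}\in\arg\min_{\boldsymbol\pi\in\mathbb B_+^K}\{-\frac1n\sum_{i=1}^n\log f_{\boldsymbol\pi}(\boldsymbol X_i)\}$. $\mathrm{KL}(f^*\|g)=\int_{\mathcal X}f^*\log\frac{f^*}{g}\,d\nu$ is the Kullback-Leibler divergence (equal to $+\infty$ if $P^*(g(\boldsymbol X)=0)>0$). For $J\subset[K]$ and $\boldsymbol v\in\mathbb R^K$, $J^c=[K]\setminus J$ and $\boldsymbol v_J\in\mathbb R^K$ has $j$-th coordinate $v_j$ if $j\in J$ and $0$ otherwise. For a positive semidefinite $K\times K$ matrix $\mathbf A$ and $c\ge0$, the compatibility constants are $$\kappa_{\mathbf A}(J,c)=\inf\Big\{\frac{c^2|J|\,\|\mathbf A^{1/2}\boldsymbol v\|_2^2}{(c\|\boldsymbol v_J\|_1-\|\boldsymbol v_{J^c}\|_1)^2}:\boldsymbol v\in\mathbb R^K,\ \|\boldsymbol v_{J^c}\|_1<c\|\boldsymbol v_J\|_1\Big\},$$ $$\bar\kappa_{\mathbf A}(J,c)=\inf\Big\{\frac{|J|\,\|\mathbf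 A^{1/2}\boldsymbol v\|_2^2}{\|\boldsymbol v_J\|_1^2}:\boldsymbol v\in\mathbb R^K,\ \|\boldsymbol v_{J^c}\|_1<c\|\boldsymbol v_J\|_1\Big\}.$$ Infima over the empty set are $+\infty$; for $J=\varnothing$ the terms proportional to $|J|$ are $0$, and for $J\neq\varnothing$ they are $+\infty$ if the compatibility constant is $0$. A function $f_0:\mathcal X\to\mathbb R$ is fixed, $\bar f_k=f_k-f_0$, and $\hat{\boldsymbol\Sigma}_n$ is the empirical Gram matrix with entries $(\hat{\boldsymbol\Sigma}_n)_{k,l}=\frac1n\sum_{i=1}^n\bar f_k(\boldsymbol X_i)\bar f_l(\boldsymbol X_i)$. *)

(* Defs.v *)
From mathcomp Require Import all_boot all_order all_algebra.
From mathcomp Require Import all_classical all_reals all_analysis.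

Set Implicit Arguments.
Unset Strict Implicit.
Unset Printing Implicit Defensive.

Import Order.TTheory GRing.Theory Num.Theory.
Import numFieldNormedType.Exports.

Local Open Scope classical_set_scope.
Local Open Scope ring_scope.

Section Densities.
Context {d : measure_display} {T : measurableType d} {R : realType}.

Definition is_density (nu : {measure set T -> \bar R}) (f : T -> R) : Prop :=
  [/\ measurable_fun setT f,
      forall x, 0 <= f x &
      (\int[nu]_x (f x)%:E = 1)%E].

(* When [g] vanishes only on a null set of [f nu], the conventions
   [a / 0 = 0] and [ln 0 = 0] only affect a null set of [f nu], and points where
   [f x = 0] contribute [0]. *)
Definition KL (nu : {measure set T -> \bar R}) (f g : T -> R) : \bar R :=
  if (0 < \int[nu]_(x in [set x | g x = 0%R]) (f x)%:E)%E then +oo%E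
  else (\int[nu]_x (f x * ln (f x / g x))%:E)%E.

Definition mixture (K : nat) (f : 'I_K -> T -> R) (pi : 'cV[R]_K) (x : T) : R :=
  \sum_j pi j 0 * f j x.

End Densities.

Section Sampling.
Context {d d' : measure_display} {Omega : measurableType d}
  {T : measurableType d'} {R : realType} {P : probability Omega R}.

Definition mutually_independent (n : nat) (X : 'I_n -> {RV P >-> T}) : Prop :=
  forall (I : {set 'I_n}) (A : 'I_n -> set T),
    (forall i, i \in I -> measurable (A i)) ->
    P (\bigcap_(i in [set` I]) (X i @^-1` A i)) =
      (\prod_(i in I) P (X i @^-1` A i))%E.

Definition has_density (X : {RV P >-> T}) (nu : {measure set T -> \bar R})
    (f : T -> R) : Prop :=
  forall A : set T, measurable A ->
    distribution P X A = (\int[nu]_(x in A) (f x)%:E)%E.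

End Sampling.

Section Vectors.
Context {R : realType} {K : nat}.
Implicit Types (v pi : 'cV[R]_K) (J : {set 'I_K}) (A B : 'M[R]_K).

Definition simplex : set 'cV[R]_K :=
  [set pi | (forall j, 0 <= pi j 0 <= 1) /\ \sum_j pi j 0 = 1].

(* The library norm on matrices is the sup norm. *)
Definition l1norm v : R := \sum_j `|v j 0|.
Definition l2norm v : R := Num.sqrt (\sum_j v j 0 ^+ 2).

Definition restr J v : 'cV[R]_K := \col_j (if j \in J then v j 0 else 0).

Definition psd A : Prop :=
  A^T = A /\ forall v, 0 <= (v^T *m A *m v) 0 0.

(* Every positive semidefinite real matrix has exactly one positive semidefinite
   square root, so the default value [0] is only taken when [A] is not
   positive semidefinite. *)
Definition sqrtmx A : 'M[R]_K := xget 0 [set B | psd B /\ B *m B = A].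

Definition kappa A J (c : R) : \bar R :=
  ereal_inf [set (c ^+ 2 * #|J|%:R * l2norm (sqrtmx A *m v) ^+ 2 /
                  (c * l1norm (restr J v) - l1norm (restr (~: J) v)) ^+ 2)%:E
            | v in [set v | l1norm (restr (~: J) v) < c * l1norm (restr J v)]].

Definition kappa_bar A J (c : R) : \bar R :=
  ereal_inf [set (#|J|%:R * l2norm (sqrtmx A *m v) ^+ 2 /
                  l1norm (restr J v) ^+ 2)%:E
            | v in [set v | l1norm (restr (~: J) v) < c * l1norm (restr J v)]].

End Vectors.

Section Empirical.
Context {T : Type} {R : realType} {K n : nat}.
Implicit Types (f : 'I_K -> T -> R) (x : 'I_n -> T).

Definition neg_loglik f x (pi : 'cV[R]_K) : R :=
  - (n%:R^-1 * \sum_i ln (\sum_j pi j 0 * f j (x i))).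

Definition is_mle f x (pihat : 'cV[R]_K) : Prop :=
  simplex pihat /\
  forall pi, simplex pi -> neg_loglik f x pihat <= neg_loglik f x pi.

Definition gram f (f0 : T -> R) x : 'M[R]_K :=
  \matrix_(k, l) (n%:R^-1 *
    \sum_i (f k (x i) - f0 (x i)) * (f l (x i) - f0 (x i))).

End Empirical.

(* Extended-real arithmetic has [0^-1 = +oo], [+oo^-1 = 0] and [0 * +oo = 0].
   Hence for [c > 0] the quotients by [n * kappa] below are [0] when [J] is empty
   (the infimum over the empty set is [+oo]) and [+oo] when [J] is nonempty and
   the compatibility constant vanishes. *)
Section Bounds.
Context {d : measure_display} {T : measurableType d} {R : realType} {K : nat}.

Definition oracle_bound (nu : {measure set T -> \bar R}) (fstar : T -> R)
    (f : 'I_K -> T -> R) (n : nat) (Sigma : 'M[R]_K) (delta c1 c2 : R) :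
    \bar R :=
  ereal_inf
    [set (KL nu fstar (mixture f pi)
          + (c1 * Num.sqrt (ln (K%:R / delta) / n%:R)
                * l1norm (restr (~: J) pi))%:E
          + (c2 * #|J|%:R * ln (K%:R / delta))%:E
              / (n%:R%:E * kappa Sigma J 3))%E
    | J in [set: {set 'I_K}] & pi in simplex].

Definition sparse_oracle_bound (nu : {measure set T -> \bar R})
    (fstar : T -> R) (f : 'I_K -> T -> R) (n : nat) (Sigma : 'M[R]_K)
    (delta c3 : R) : \bar R :=
  ereal_inf
    [set ereal_inf
      [set (KL nu fstar (mixture f pi)
            + (c3 * #|J|%:R * ln (K%:R / delta))%:E
                / (n%:R%:E * kappa_bar Sigma J 1))%E
      | pi in [set pi | simplex pi /\ restr (~: J) pi = 0]]
    | J in [set: {set 'I_K}]].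

End Bounds.

(* Main.v *)
Require Import Defs.
From mathcomp Require Import all_boot all_order all_algebra.
From mathcomp Require Import all_classical all_reals all_analysis.
From mathcomp Require Import measurable_realfun ring lra.

Import Order.TTheory GRing.Theory Num.Theory.
Import numFieldNormedType.Exports.

Local Open Scope classical_set_scope.
Local Open Scope ring_scope.

(** The proof compares [pihat] with an arbitrary [pi] in the simplex. Write
    [v = pihat - pi], let [dev h] be the empirical mean of [h] minus its
    expectation, and [A] the empirical Gram form of [v]. Then
    [KL (f_pihat) - KL (f_pi) = E (ln f_pi - ln f_pihat)
       = P_n (ln f_pi - ln f_pihat) - dev (ln f_pi - ln f_pihat)].

    By optimality of [pihat] and strong concavity of [ln] on the interval from
    0 to [M], the empirical term is at most [- A / (2 M ^ 2)]
    ([mle_quadratic_gap]).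

    The deviation is at most [zeta * l1norm v] with
    [zeta = 8 V ^ 3 (ln (K / delta) / n) ^ (1 / 2)], uniformly in [pi] and
    [pihat], on an event of probability at least [1 - delta]. This needs neither
    symmetrization nor contraction: in the Taylor expansion of [ln] at [M], with
    [w_pi = 1 - f_pi / M], the difference of the terms of order [k + 1] is, up to
    sign and the factor [1 / (k + 1)], a sum over [j] of [v_j] times a sum of
    [k + 1] products of [f_j / M] with [k] factors [w_pi] or [w_pihat], and each such product is a
    convex combination of the [K ^ (k + 1)] functions
    [(f_l / M) * \prod_(i < k) (1 - f_(s i) / M)], which are bounded by
    [(1 - m / M) ^ k]. Hoeffding's inequality ([Hoeffding]) and a union bound
    over all of them ([monomial_deviation_event]) cost a factor [k + 1] at order
    [k], and [\sum_k (k + 1) (1 - m / M) ^ k <= V ^ 2]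
    ([log_mixture_deviation]).

    Finally [zeta * l1norm v - A / (2 M ^ 2)] is bounded through the
    compatibility constants, using that the coordinates of [v] sum to zero
    ([kappa_oracle], [kappa_bar_oracle]). When [KL (f_pi)] is infinite there is
    nothing to prove ([KL_le_add]). *)

(** * Integration against an image measure *)

Section WeightedPushforward.
Context {dS dT : measure_display} {S : measurableType dS}
  {T : measurableType dT} {R : realType}.
Variables (mu : {measure set S -> \bar R}) (Q : {measure set T -> \bar R}).
Variables (phi : S -> T) (W : S -> R).
Hypothesis mphi : measurable_fun setT phi.
Hypothesis mW : measurable_fun setT W.
Hypothesis W0 : forall s, 0 <= W s.
Hypothesis HQ : forall A, measurable A ->
  (\int[mu]_(s in phi @^-1` A) (W s)%:E = Q A)%E.

Import HBNNSimple.

(** If the image under [phi] of the measure with density [W] is [Q], then the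
    same holds for integrals of nonnegative functions, by approximation with
    simple functions. The lemma serves twice: to factor expectations of
    independent variables, and to pass from the density [fstar] to the law of
    the sample. *)
Lemma ge0_integral_weighted_pushforward (g : T -> \bar R) :
  measurable_fun [set: T] g -> (forall x, 0 <= g x)%E ->
  (\int[mu]_s (g (phi s) * (W s)%:E) = \int[Q]_x g x)%E.
Proof.
move=> mg g0.
have mEW : measurable_fun setT (EFin \o W) by exact/measurable_EFinP.
have mphiA A : measurable A -> measurable (phi @^-1` A).
  by move=> mA; rewrite -(setTI (_ @^-1` _)); exact: mphi.
pose h := nnsfun_approx measurableT mg.
have cvgh x : (h n x)%:E @[n --> \oo] --> g x by exact: cvg_nnsfun_approx.
have -> : (\int[Q]_x g x = limn (fun n => \int[Q]_x (h n x)%:E))%E.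
  rewrite -monotone_convergence//.
  - by apply: eq_integral => x _; apply/esym/cvg_lim.
  - by move=> n; exact/measurable_EFinP/measurable_funP.
  - by move=> n x _; rewrite lee_fin.
  - by move=> x _ a b ab; rewrite lee_fin; exact/lefP/nd_nnsfun_approx.
have mhphi n : measurable_fun setT (h n \o phi).
  by apply: measurableT_comp => //; exact: measurable_funP.
transitivity (limn (fun n => \int[mu]_s ((h n (phi s))%:E * (W s)%:E)))%E.
  rewrite -monotone_convergence//.
  - apply: eq_integral => s _; apply/esym/cvg_lim => //.
    by apply: cvgeZr => //; exact: cvgh.
  - move=> n; apply: emeasurable_funM; last exact: mEW.
    by apply/measurable_EFinP; exact: mhphi.
  - by move=> n s _; rewrite mule_ge0// lee_fin.
  - move=> s _ a b ab; rewrite lee_wpmul2r ?lee_fin//.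
    exact/lefP/nd_nnsfun_approx.
apply: congr_lim; apply/funext => n.
have mindic r : measurable_fun setT
    (fun s : S => \1_(h n @^-1` [set r]) (phi s) : R).
  rewrite (_ : (fun s => _) = \1_(phi @^-1` (h n @^-1` [set r]))).
    by apply: measurable_indic; exact: mphiA.
  by apply/funext => s; rewrite !indicE; congr (nat_of_bool _)%:R; rewrite !inE.
have m1 r : measurable_fun setT
    (fun s : S => (r * \1_(h n @^-1` [set r]) (phi s))%:E).
  by apply/measurable_EFinP; exact: measurable_funM.
transitivity (\int[mu]_s (\sum_(y \in range (h n))
    ((y * \1_(h n @^-1` [set y]) (phi s))%:E * (W s)%:E)))%E.
  apply: eq_integral => s _.
  rewrite -ge0_mule_fsuml => [|y]; last exact: nnfun_muleindic_ge0.
  by rewrite fsumEFin// -(fimfunE (h n) (phi s)).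
rewrite ge0_integral_fsum//; last 2 first.
  - by move=> y; apply: emeasurable_funM.
  - by move=> y s _; rewrite mule_ge0 ?lee_fin// -lee_fin nnfun_muleindic_ge0.
transitivity (\int[Q]_x (\sum_(y \in range (h n))
   (y * \1_(h n @^-1` [set y]) x)%:E))%E; last first.
  by apply: eq_integral => x _; rewrite fsumEFin// -(fimfunE (h n) x).
rewrite ge0_integral_fsum//; last 2 first.
  - move=> y; apply/measurable_EFinP; exact: measurable_funM.
  - by move=> y x _; exact: nnfun_muleindic_ge0.
apply: eq_fsbigr => r /[!inE] -[t _ rE].
have r0 : 0 <= r by rewrite -rE.
under [RHS]eq_integral do rewrite EFinM.
rewrite integralZl_indic_nnsfun => //.
rewrite integral_indic// setIT.
under eq_integral do rewrite EFinM -muleA.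
have mA : measurable (h n @^-1` [set r]) by [].
rewrite ge0_integralZl//; last 2 first.
- apply: emeasurable_funM => //.
  by apply/measurable_EFinP; exact: mindic.
- by move=> s _; rewrite mule_ge0 ?lee_fin.
congr *%E.
rewrite -HQ//.
rewrite [RHS]integral_mkcond; apply: eq_integral => s _.
rewrite /patch indicE; case: ifPn => hs.
  have -> : (phi s \in h n @^-1` [set r]) by move: hs; rewrite !inE.
  by rewrite mul1e.
have -> : (phi s \in h n @^-1` [set r]) = false.
  by apply/negbTE; move: hs; apply: contra; rewrite !inE.
by rewrite mul0e.
Qed.

End WeightedPushforward.

(** * Bounded measurable functions and independence *)

Section BoundedMeasurable.
Context {d : measure_display} {T : measurableType d} {R : realType}.
Implicit Types (h g : T -> R) (Q : probability T R).

(** Bounded measurable real functions; these are integrable for every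
    probability, so that their integrals are real and linear. *)
Definition bounded_measurable h :=
  measurable_fun [set: T] h /\ exists C, forall x, `|h x| <= C.

Lemma bounded_measurable_cst (c : R) : bounded_measurable (fun=> c).
Proof. by split; [exact: measurable_cst|exists `|c|]. Qed.

Lemma bounded_measurableD h g : bounded_measurable h -> bounded_measurable g ->
  bounded_measurable (fun x => h x + g x).
Proof.
move=> [mh [C hC]] [mg [D hD]]; split; first exact: measurable_funD.
by exists (C + D) => x; rewrite (le_trans (ler_normD _ _))// lerD.
Qed.

Lemma bounded_measurableM h g : bounded_measurable h -> bounded_measurable g ->
  bounded_measurable (fun x => h x * g x).
Proof.
move=> [mh [C hC]] [mg [D hD]]; split; first exact: measurable_funM.
by exists (C * D) => x; rewrite normrM ler_pM.
Qed.

Lemma bounded_measurableZ (c : R) h : bounded_measurable h ->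
  bounded_measurable (fun x => c * h x).
Proof. by move=> bh; apply: bounded_measurableM => //; exact: bounded_measurable_cst. Qed.

Lemma bounded_measurableB h g : bounded_measurable h -> bounded_measurable g ->
  bounded_measurable (fun x => h x - g x).
Proof.
move=> bh bg; rewrite (_ : (fun x => _) = (fun x => h x + (-1) * g x)).
  by apply: bounded_measurableD => //; exact: bounded_measurableZ.
by apply/funext => x; rewrite mulN1r.
Qed.

Lemma bounded_measurable_sum (I : Type) (r : seq I) (F : I -> T -> R) :
  (forall i, bounded_measurable (F i)) ->
  bounded_measurable (fun x => \sum_(i <- r) F i x).
Proof.
move=> bF; elim: r => [|i r IH].
  rewrite (_ : (fun x => _) = fun=> 0); first exact: bounded_measurable_cst.
  by apply/funext => x; rewrite big_nil.
rewrite (_ : (fun x => _) = fun x => F i x + \sum_(j <- r) F j x).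
  exact: bounded_measurableD.
by apply/funext => x; rewrite big_cons.
Qed.

Lemma bounded_measurable_prod (I : Type) (r : seq I) (p : pred I) (F : I -> T -> R) :
  (forall i, bounded_measurable (F i)) ->
  bounded_measurable (fun x => \prod_(i <- r | p i) F i x).
Proof.
move=> bF; elim: r => [|i r IH].
  rewrite (_ : (fun x => _) = fun=> 1); first exact: bounded_measurable_cst.
  by apply/funext => x; rewrite big_nil.
have [pi|pi] := boolP (p i).
  rewrite (_ : (fun x => _) = fun x => F i x * \prod_(j <- r | p j) F j x).
    exact: bounded_measurableM.
  by apply/funext => x; rewrite big_cons pi.
rewrite (_ : (fun x => _) = fun x => \prod_(j <- r | p j) F j x) //.
by apply/funext => x; rewrite big_cons (negbTE pi).
Qed.

Lemma bounded_measurable_integrable Q h : bounded_measurable h ->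
  Q.-integrable [set: T] (EFin \o h).
Proof.
move=> [mh [C hC]]; apply: measurable_bounded_integrable => //.
  by rewrite (le_lt_trans (probability_le1 _ _)) // ltry.
exists C; split; first exact: num_real.
by move=> D CD x _ /=; apply: le_trans (hC x) _; exact: ltW.
Qed.

Lemma EFin_Rintegral Q h : bounded_measurable h ->
  (\int[Q]_x (h x)%:E)%E = (\int[Q]_x h x)%:E.
Proof.
move=> bh; rewrite /Rintegral fineK//.
by apply: integrable_fin_num => //; exact: bounded_measurable_integrable.
Qed.

End BoundedMeasurable.

Lemma bounded_measurable_comp {d d' : measure_display} {S : measurableType d'}
    {T : measurableType d} {R : realType} (phi : S -> T) (h : T -> R) :
  measurable_fun [set: S] phi -> bounded_measurable h ->
  bounded_measurable (fun s => h (phi s)).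
Proof.
move=> mphi [mh [C hC]]; split; last by exists C => s; exact: hC.
exact: (measurableT_comp mh mphi).
Qed.

Section Independence.
Context {d d' : measure_display} {Omega : measurableType d}
  {T : measurableType d'} {R : realType} {P : probability Omega R}.
Variables (n : nat) (X : 'I_n -> {RV P >-> T}).
Hypothesis indepX : mutually_independent X.

(** Expectations of products of independent variables factor. Independence is
    the case of indicators; the induction on [k] replaces the indicators by
    arbitrary functions one coordinate at a time, and in each step the other
    factors form the weight [W]. *)
Lemma Rintegral_prod_indep (G : 'I_n -> T -> R) :
  (forall i, bounded_measurable (G i)) -> (forall i x, 0 <= G i x) ->
  \int[P]_w \prod_i G i (X i w) = \prod_i \int[P]_w G i (X i w).
Proof.
have mX i : measurable_fun [set: Omega] (X i) by exact: measurable_funP.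
(* Coordinates before k are arbitrary, the others are indicators. *)
suff H k : forall G : 'I_n -> T -> R,
    (forall i, bounded_measurable (G i)) -> (forall i x, 0 <= G i x) ->
    (forall i : 'I_n, (k <= i)%N -> exists2 A, measurable A & G i = \1_A) ->
    \int[P]_w \prod_i G i (X i w) = \prod_i \int[P]_w G i (X i w).
  move=> bG G0; apply: (H n) => // i; by rewrite leqNgt ltn_ord.
elim: k => [|k IH] {}G bG G0 indG.
  have /choice[A HA] : forall i, exists A, measurable A /\ G i = \1_A.
    by move=> i; have [A mA ->] := indG i (leq0n _); exists A.
  have mXA i : measurable (X i @^-1` A i).
    by rewrite -(setTI (_ @^-1` _)); apply: mX => //; exact: (HA i).1.
  have /= IT := indepX [set: 'I_n]%SET A (fun i _ => (HA i).1).
  transitivity (fine (P (\bigcap_(i in [set` [set: 'I_n]%SET]) (X i @^-1` A i)))).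
    have mI : measurable (\bigcap_(i in [set` [set: 'I_n]%SET]) (X i @^-1` A i)).
      by apply: fin_bigcap_measurable => // i _; exact: mXA.
    rewrite /Rintegral -[in RHS](setIT (\bigcap_(i in _) _)) -integral_indic//.
    congr fine; apply: eq_integral => w _; congr EFin.
    rewrite indicE; case: (boolP (w \in _)) => [/set_mem wA|/negP wA] /=.
      apply: big1 => i _; rewrite (HA i).2 indicE mem_set//.
      by apply: wA; rewrite /= inE.
    have [i wi] : exists i, X i w \notin A i.
      apply: contrapT => wA'; apply: wA; apply: mem_set => i _ /=.
      by apply: contrapT => wi; apply: wA'; exists i; rewrite notin_setE.
    by rewrite (bigD1 i)//= (HA i).2 indicE (negbTE wi) mul0r.
  rewrite IT.
  have -> : (\prod_(i in [set: 'I_n]%SET) P (X i @^-1` A i) =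
     \prod_i (\int[P]_w G i (X i w))%:E)%E.
    apply: eq_big => [i|i _]; first by rewrite inE.
    rewrite -EFin_Rintegral; last exact: bounded_measurable_comp.
    rewrite -[in LHS](setIT (_ @^-1` _)) -integral_indic//.
    by apply: eq_integral => w _; rewrite (HA i).2 !indicE.
  by rewrite -(big_morph EFin EFinM erefl).
have [kn|kn] := ltnP k n; last first.
  apply: IH => // i ki; exfalso; have := ltn_ord i.
  by rewrite ltnNge (leq_trans kn ki).
pose i0 := Ordinal kn.
pose W w := \prod_(i | i != i0) G i (X i w).
pose c := \prod_(i | i != i0) \int[P]_w G i (X i w).
have bW : bounded_measurable W.
  by apply: bounded_measurable_prod => i; exact: bounded_measurable_comp.
have W0 w : 0 <= W w by apply: prodr_ge0.
have c0 : 0 <= c by apply: prodr_ge0 => i _; apply: Rintegral_ge0.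
have HA A : measurable A ->
    (\int[P]_(w in X i0 @^-1` A) (W w)%:E =
      mscale (NngNum c0) (distribution P (X i0)) A)%E.
  move=> mA; have mXA : measurable (X i0 @^-1` A).
    by rewrite -(setTI (_ @^-1` _)); exact: mX.
  pose G' i := if i == i0 then \1_A else G i.
  have bG' i : bounded_measurable (G' i).
    rewrite /G'; case: ifP => // _; split; first exact: measurable_indic.
    by exists 1 => x; rewrite indicE; case: (_ \in _); rewrite ?normr0 ?normr1.
  have := IH G' bG'; rewrite (bigD1 i0)//=.
  have -> : \prod_(i | i != i0) \int[P]_w G' i (X i w) = c.
    by apply: eq_bigr => i ii0; rewrite /G' (negbTE ii0).
  have -> : (fun w => \prod_i G' i (X i w)) = (fun w => \1_(X i0 @^-1` A) w * W w).
    apply/funext => w; rewrite (bigD1 i0)//= {1}/G' eqxx.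
    congr (_ * _); apply: eq_bigr => i ii0; by rewrite /G' (negbTE ii0).
  have -> : G' i0 = \1_A by rewrite /G' eqxx.
  move=> IHA.
  rewrite integral_mkcond.
  transitivity (\int[P]_w (\1_(X i0 @^-1` A) w * W w)%:E)%E.
    apply: eq_integral => w _; rewrite /patch indicE.
    by case: ifP => _; rewrite ?mul1r ?mul0r.
  rewrite EFin_Rintegral; last first.
    apply: bounded_measurableM => //; split; first exact: measurable_indic.
    by exists 1 => x; rewrite indicE; case: (_ \in _); rewrite ?normr0 ?normr1.
  rewrite IHA; last 2 first.
  - by move=> i x; rewrite /G'; case: ifP.
  - move=> i; rewrite leq_eqVlt => /orP[/eqP ki|ki]; rewrite /G'.
      by have -> : i = i0 by [apply/val_inj]; rewrite eqxx; exists A.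
    case: ifP => _; last exact: indG.
    by exists A.
  rewrite /mscale/= /distribution /pushforward mulrC EFinM; congr *%E.
  rewrite /Rintegral fineK; last first.
    apply: integrable_fin_num => //.
    exact: (integrable_indic _ mXA).
  by rewrite -[in RHS](setIT (_ @^-1` _)) -integral_indic.
have := @ge0_integral_weighted_pushforward _ _ _ _ _ _ _ _ _
  (mX i0) bW.1 W0 HA (EFin \o G i0).
rewrite ge0_integral_mscale//; last 2 first.
  by apply/measurable_EFinP; exact: (bG i0).1.
  by move=> x _; rewrite /= lee_fin.
rewrite ge0_integral_distribution//; last 2 first.
  by apply/measurable_EFinP; exact: (bG i0).1.
  by move=> x; rewrite /= lee_fin.
move=> HG.
apply: EFin_inj.
rewrite -EFin_Rintegral; last first.
  by apply: bounded_measurable_prod => i; exact: bounded_measurable_comp.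
rewrite (bigD1 i0)//= -/c mulrC EFinM -(EFin_Rintegral _ (fun w => G i0 (X i0 w))); last first.
  exact: bounded_measurable_comp.
rewrite -HG; last 2 first.
  by apply/measurable_EFinP; exact: (bG i0).1.
  by move=> x; rewrite /= lee_fin.
by apply: eq_integral => w _ /=; rewrite (bigD1 i0).
Qed.

End Independence.

(** * Empirical deviations and Hoeffding's inequality *)

Section Deviation.
Context {d : measure_display} {T : measurableType d} {R : realType}.

(** The difference between the mean of [h] over the points [x] and its integral
    under [Q]. It is linear on bounded measurable functions. *)
Definition empirical_deviation (n : nat) (x : 'I_n -> T) (Q : probability T R)
    (h : T -> R) : R :=
  n%:R^-1 * \sum_i h (x i) - \int[Q]_y h y.

Variables (n : nat) (x : 'I_n -> T) (Q : probability T R).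
Local Notation dev := (empirical_deviation n x Q).

Lemma empirical_deviationD h g :
  bounded_measurable h -> bounded_measurable g ->
  dev (fun y => h y + g y) = dev h + dev g.
Proof.
move=> bh bg; rewrite /empirical_deviation RintegralD//; last 2 first.
- exact: bounded_measurable_integrable.
- exact: bounded_measurable_integrable.
rewrite big_split/= mulrDr; ring.
Qed.

Lemma empirical_deviationZ c h : bounded_measurable h ->
  dev (fun y => c * h y) = c * dev h.
Proof.
move=> bh; rewrite /empirical_deviation RintegralZl//; last first.
  exact: bounded_measurable_integrable.
rewrite -mulr_sumr; ring.
Qed.

Lemma empirical_deviation_sum (I : Type) (r : seq I) (F : I -> T -> R) :
  (forall i, bounded_measurable (F i)) ->
  dev (fun y => \sum_(i <- r) F i y) = \sum_(i <- r) dev (F i).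
Proof.
move=> bF; elim: r => [|i r IH].
  rewrite big_nil (_ : (fun y => _) = (fun y => 0 * 1)); last first.
    by apply/funext => y; rewrite big_nil mul0r.
  by rewrite empirical_deviationZ ?mul0r//; exact: bounded_measurable_cst.
rewrite big_cons (_ : (fun y => _) = (fun y => F i y + \sum_(j <- r) F j y)).
  rewrite empirical_deviationD// ?IH//; exact: bounded_measurable_sum.
by apply/funext => y; rewrite big_cons.
Qed.

Lemma Rintegral_cst1 : \int[Q]_y (1 : R) = 1.
Proof. by rewrite Rintegral_cst//= probability_setT mul1r. Qed.

Lemma Rintegral_le_bound h a b : bounded_measurable h ->
  (forall y, a <= h y <= b) -> a <= \int[Q]_y h y <= b.
Proof.
move=> bh hab.
have Ec c : \int[Q]_y (c : R) = c.
  by rewrite Rintegral_cst//= probability_setT mulr1.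
apply/andP; split.
  rewrite -[leLHS](Ec a); apply: le_Rintegral => //.
  - exact: (bounded_measurable_integrable Q _ (bounded_measurable_cst a)).
  - exact: bounded_measurable_integrable.
  - by move=> y _; case/andP: (hab y).
rewrite -[leRHS](Ec b); apply: le_Rintegral => //.
- exact: bounded_measurable_integrable.
- exact: (bounded_measurable_integrable Q _ (bounded_measurable_cst b)).
- by move=> y _; case/andP: (hab y).
Qed.

Lemma empirical_mean_bound (h : T -> R) a b : (0 < n)%N ->
  (forall y, a <= h y <= b) -> a <= n%:R^-1 * \sum_i h (x i) <= b.
Proof.
move=> n0 hab; have n0' : 0 < n%:R :> R by rewrite ltr0n.
rewrite mulrC ler_pdivlMr// ler_pdivrMr//.
have Hc c : c * n%:R = \sum_(i < n) c :> R.
  by rewrite sumr_const card_ord mulr_natr.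
by rewrite !Hc; apply/andP; split; apply: ler_sum => i _; case/andP: (hab (x i)).
Qed.

Lemma empirical_deviation_le_bound h a b : (0 < n)%N -> bounded_measurable h ->
  (forall y, a <= h y <= b) -> `|dev h| <= b - a.
Proof.
move=> n0 bh hab.
have /andP[h1 h2] := Rintegral_le_bound _ _ _ bh hab.
have /andP[h3 h4] := empirical_mean_bound _ _ _ n0 hab.
rewrite /empirical_deviation ler_norml; apply/andP; split; lra.
Qed.

End Deviation.

(** From [expR (- y) >= 1 - y]: for [y <= 1 / 2], [(1 - y)^-1 <= 1 + y + 2 y ^ 2]. *)
Lemma expR_le_quadratic {R : realType} (y : R) : y <= 2^-1 ->
  expR y <= 1 + y + 2 * y ^+ 2.
Proof.
move=> y2; have y1 : 0 < 1 - y by lra.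
have : (1 - y) * expR y <= 1.
  rewrite -[leRHS](expRxMexpNx_1 y) mulrC ler_pM2l ?expR_gt0//.
  exact: expR_ge1Dx.
move=> H; rewrite -(ler_pM2l y1) (le_trans H)//.
have y0 : 0 <= y ^+ 2 by exact: sqr_ge0.
have : 0 <= y ^+ 2 * (1 - 2 * y) by apply: mulr_ge0 => //; lra.
rewrite !expr2; nra.
Qed.

Section Hoeffding.
Context {d d' : measure_display} {Omega : measurableType d}
  {T : measurableType d'} {R : realType} {P : probability Omega R}.
Variables (n : nat) (X : 'I_n -> {RV P >-> T}) (Q : probability T R).
Hypothesis n0 : (0 < n)%N.
Hypothesis indepX : mutually_independent X.
Hypothesis lawX : forall i h, bounded_measurable h ->
  \int[P]_w h (X i w) = \int[Q]_y h y.

Let mX i : measurable_fun [set: Omega] (X i).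
Proof. exact: measurable_funP. Qed.

Local Notation dev h w := (empirical_deviation n (fun i => X i w) Q h).

Lemma measurable_empirical_deviation h : measurable_fun [set: T] h ->
  measurable_fun [set: Omega] (fun w => dev h w).
Proof.
move=> mh; apply: measurable_funB => //.
apply: measurable_funM => //; apply: measurable_sum => i.
exact: (measurableT_comp mh (mX i)).
Qed.

(** Chernoff bound. The constant 8 is not optimal; it comes from the elementary
    estimate [expR_le_quadratic] of the moment generating function. *)
Lemma Hoeffding_upper h t : bounded_measurable h ->
  (forall y, 0 <= h y <= 1) -> 0 <= t ->
  (P [set w | (t <= dev h w)%R] <= (expR (- (n%:R * t ^+ 2 / 8)))%:E)%E.
Proof.
move=> bh h01 t0.
have mh := measurable_empirical_deviation _ bh.1.
have mA : measurable [set w | t <= dev h w].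
  rewrite (_ : [set w | _] = (fun w => dev h w) @^-1` `[t, +oo[%classic); last first.
    by apply/seteqP; split=> w /=; rewrite in_itv/= andbT.
  by rewrite -(setTI (_ @^-1` _)); exact: mh.
(* A deviation of a function with values in [0, 1] never exceeds 1. *)
have [t1|t1] := ltP 1 t.
  rewrite (_ : [set w | _] = set0) ?measure0 ?lee_fin ?expR_ge0//.
  apply/seteqP; split=> w //= tw.
  have := empirical_deviation_le_bound n (fun i => X i w) Q _ _ _ n0 bh h01.
  move=> /(le_trans (ler_norm _)) => /(le_trans tw); rewrite subr0 => H.
  by have := lt_le_trans t1 H; rewrite ltxx.
pose mu := \int[Q]_y h y.
have /andP[mu0 mu1] : 0 <= mu <= 1 by exact: Rintegral_le_bound.
(* The minimizer of l |-> 2 l ^ 2 - l t; since t <= 1, l <= 1 / 4, so the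
   quadratic bound on expR applies. *)
pose l := t / 4.
pose g y := expR (l * (h y - mu)).
have bg : bounded_measurable g.
  split.
    apply: (measurableT_comp (f := @expR R)) => //.
    apply: measurable_funM => //; apply: measurable_funB => //; exact: bh.1.
  exists (expR l) => y; rewrite ger0_norm ?expR_ge0// ler_expR.
  have /andP[? ?] := h01 y; rewrite /l; nra.
have Eg : \int[Q]_y g y <= expR (2 * l ^+ 2).
  pose q y := (1 + 2 * l ^+ 2) + l * (h y - mu).
  have bq : bounded_measurable (fun y => h y - mu).
    by apply: bounded_measurableB => //; exact: bounded_measurable_cst.
  have bl : bounded_measurable (fun y => l * (h y - mu)).
    by apply: bounded_measurableZ.
  apply: (@le_trans _ _ (\int[Q]_y q y)).
    apply: le_Rintegral => //.
    - exact: bounded_measurable_integrable.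
    - apply: bounded_measurable_integrable; apply: bounded_measurableD => //.
      exact: bounded_measurable_cst.
    move=> y _; have /andP[? ?] := h01 y.
    apply: le_trans (expR_le_quadratic _ _) _.
      rewrite /l; nra.
    have : (l * (h y - mu)) ^+ 2 <= l ^+ 2.
      rewrite exprMn -[leRHS]mulr1 ler_wpM2l ?sqr_ge0// expr2; nra.
    rewrite /q; lra.
  rewrite /q RintegralD//; last 2 first.
  - exact: (bounded_measurable_integrable Q _ (bounded_measurable_cst _)).
  - exact: bounded_measurable_integrable.
  rewrite RintegralZl//; last exact: bounded_measurable_integrable.
  rewrite RintegralB//; last 2 first.
  - exact: bounded_measurable_integrable.
  - exact: (bounded_measurable_integrable Q _ (bounded_measurable_cst _)).
  rewrite !Rintegral_cst//= probability_setT /= !mulr1 -/mu subrr mulr0 addr0.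
  exact: expR_ge1Dx.
pose Z w := \prod_i g (X i w).
have bZ : bounded_measurable Z.
  by apply: bounded_measurable_prod => i; exact: bounded_measurable_comp.
have EZ : \int[P]_w Z w <= expR (n%:R * (2 * l ^+ 2)).
  rewrite (Rintegral_prod_indep _ _ indepX (fun=> g))//; last first.
    by move=> i y; exact: expR_ge0.
  have -> : expR (n%:R * (2 * l ^+ 2)) = \prod_(i < n) expR (2 * l ^+ 2).
    by rewrite prodr_const card_ord expRM_natl.
  apply: ler_prod => i _; rewrite lawX// Eg andbT.
  by apply: Rintegral_ge0 => y _; exact: expR_ge0.
have b1 : bounded_measurable (\1_[set w | t <= dev h w] : Omega -> R).
  split; first exact: measurable_indic.
  by exists 1 => y; rewrite indicE; case: (_ \in _); rewrite ?normr0 ?normr1.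
rewrite -(setIT [set w | _]) -integral_indic// EFin_Rintegral// lee_fin.
apply: (@le_trans _ _ (\int[P]_w (expR (- (l * (n%:R * t))) * Z w))).
  apply: le_Rintegral => //.
  - exact: bounded_measurable_integrable.
  - by apply: bounded_measurable_integrable; exact: bounded_measurableZ.
  move=> w _; rewrite indicE; case: (boolP (w \in _)) => [/set_mem /= tw|_]; last first.
    by rewrite mulr_ge0 ?expR_ge0//; apply: prodr_ge0 => i _; exact: expR_ge0.
  rewrite /Z /g -expR_sum -expRD -[leLHS]expR0 ler_expR.
  rewrite -mulr_sumr -mulrN -mulrDr; apply: mulr_ge0; first by rewrite /l; lra.
  rewrite sumrB sumr_const card_ord -[mu *+ n]mulr_natl.
  have n0' : 0 < n%:R :> R by rewrite ltr0n.
  have : n%:R * t <= n%:R * dev h w by rewrite ler_pM2l.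
  rewrite /empirical_deviation mulrBr mulVKf ?gt_eqF// -/mu; lra.
rewrite RintegralZl//; last exact: bounded_measurable_integrable.
apply: (@le_trans _ _ (expR (- (l * (n%:R * t))) * expR (n%:R * (2 * l ^+ 2)))).
  by rewrite ler_pM2l ?expR_gt0.
rewrite -expRD ler_expR /l expr2.
by rewrite le_eqVlt; apply/orP; left; apply/eqP; field.
Qed.

Lemma measurable_deviation_gt h t : bounded_measurable h ->
  measurable [set w | t < `|dev h w|].
Proof.
move=> bh; have mh := measurable_empirical_deviation _ bh.1.
rewrite (_ : [set w | _] = (fun w => `|dev h w|) @^-1` `]t, +oo[%classic); last first.
  by apply/seteqP; split=> w /=; rewrite in_itv/= andbT.
rewrite -(setTI (_ @^-1` _)).
have : measurable_fun [set: Omega] (fun w => `|dev h w|).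
  by apply: measurableT_comp mh.
exact.
Qed.

Lemma Hoeffding h t : bounded_measurable h ->
  (forall y, 0 <= h y <= 1) -> 0 <= t ->
  (P [set w | (t < `|dev h w|)%R] <= (2 * expR (- (n%:R * t ^+ 2 / 8)))%:E)%E.
Proof.
move=> bh h01 t0.
pose h' y := 1 - h y.
have bh' : bounded_measurable h'.
  by apply: bounded_measurableB => //; exact: bounded_measurable_cst.
have h'01 y : 0 <= h' y <= 1 by have := h01 y; rewrite /h'; lra.
have devh' w : dev h' w = - dev h w.
  rewrite /h' (_ : (fun y => _) = (fun y => 1 + (-1) * h y)); last first.
    by apply/funext => y; rewrite mulN1r.
  rewrite empirical_deviationD//; last 2 first.
  - exact: bounded_measurable_cst.
  - exact: bounded_measurableZ.
  rewrite empirical_deviationZ// mulN1r.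
  rewrite {1}/empirical_deviation Rintegral_cst1 sumr_const card_ord.
  by rewrite mulVf ?subrr ?add0r// pnatr_eq0 -lt0n.
have m0 h1 : bounded_measurable h1 -> measurable [set w | t <= dev h1 w].
  move=> bh1.
  rewrite (_ : [set w | _] = (fun w => dev h1 w) @^-1` `[t, +oo[%classic); last first.
    by apply/seteqP; split=> w /=; rewrite in_itv/= andbT.
  rewrite -(setTI (_ @^-1` _)); apply: measurable_empirical_deviation => //.
  exact: bh1.1.
have mU : measurable ([set w | t <= dev h w] `|` [set w | t <= dev h' w]).
  by apply: measurableU; exact: m0.
have mA := measurable_deviation_gt h t bh.
apply: (@le_trans _ _ (P ([set w | t <= dev h w] `|` [set w | t <= dev h' w]))).
  apply: le_measure; rewrite ?inE// => w /=.
  by rewrite devh' ltr_normr => /orP[] /ltW; [left|right].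
apply: (le_trans (measureU2 _ _ _)); [exact: m0|exact: m0|].
by rewrite mulr_natl mulr2n EFinD; apply: leeD; exact: Hoeffding_upper.
Qed.

End Hoeffding.

(** * Taylor expansion and strong concavity of the logarithm *)

Section LogExpansion.
Context {R : realType}.

(** The mean value theorem on the positive half-line, for two points in either order. *)
Lemma MVT_pos (F dF : R -> R) (a b : R) :
  (forall x : R, 0 < x -> is_derive x (1 : R) F (dF x)) -> 0 < a -> 0 < b ->
  exists2 c, Num.min a b <= c <= Num.max a b & F b - F a = dF c * (b - a).
Proof.
move=> HF.
have H a' b' : 0 < a' -> a' <= b' ->
    exists2 c, a' <= c <= b' & F b' - F a' = dF c * (b' - a').
  move=> a0 ab.
  have [||c] := @MVT_segment R F dF a' b' ab.
  - move=> x; rewrite in_itv/= => /andP[ax _]; apply: HF; exact: lt_trans ax.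
  - apply: derivable_within_continuous => x; rewrite in_itv/= => /andP[ax _].
    by have [] := HF x (lt_le_trans a0 ax).
  by rewrite in_itv/= => cab E; exists c.
move=> a0 b0; have [ab|ba] := leP a b; first exact: H.
have [c cba E] := H b a b0 (ltW ba).
by exists c => //; rewrite -[LHS]opprB E -mulrN opprB.
Qed.

(** The error of the Taylor polynomial of degree [N] of [ln] at [M], up to the
    constant [ln M]: with [w = 1 - u / M], [ln u = ln M - \sum_(k >= 1) w ^ k / k]. *)
Definition log_remainder (M : R) (N : nat) (u : R) : R :=
  ln u + \sum_(k < N) (k.+1%:R^-1 * (1 - u / M) ^+ k.+1).

(** The derivative telescopes: [w ^ N / u - w ^ N / M = w ^ N.+1 / u]. *)
Lemma is_derive_log_remainder (M u : R) (N : nat) : 0 < M -> 0 < u ->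
  is_derive u (1 : R) (log_remainder M N) ((1 - u / M) ^+ N / u).
Proof.
move=> M0 u0; elim: N => [|N IH].
  rewrite (_ : log_remainder M 0 = @ln R).
    by rewrite expr0 div1r; exact: is_derive1_ln.
  by apply/funext => v; rewrite /log_remainder big_ord0 addr0.
pose w : R -> R := cst 1 - (M^-1 *: id).
have dw : is_derive u 1 w (- M^-1).
  have -> : - M^-1 = 0 - M^-1 *: (1 : R) by rewrite /GRing.scale/= mulr1 sub0r.
  exact: is_deriveB.
rewrite (_ : log_remainder M N.+1 = log_remainder M N + N.+1%:R^-1 *: (w ^+ N.+1)).
  have -> : (1 - u / M) ^+ N.+1 / u =
      (1 - u / M) ^+ N / u + N.+1%:R^-1 *: ((N.+1%:R * w u ^+ N) *: - M^-1).
    rewrite /w /= !fctE /= /GRing.scale /= (mulrC M^-1) exprS.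
    have N0 : N.+1%:R != 0 :> R by rewrite pnatr_eq0.
    by field; rewrite nat1r N0 !gt_eqF.
  exact: is_deriveD.
apply/funext => v; rewrite /log_remainder big_ord_recr /= addrA !fctE; congr (_ + _).
by rewrite /w !fctE /GRing.scale /= (mulrC M^-1).
Qed.

Lemma log_remainder_lipschitz (m M : R) (N : nat) (u u' : R) : 0 < m -> m <= M ->
  m <= u <= M -> m <= u' <= M ->
  `|log_remainder M N u' - log_remainder M N u| <=
    (1 - m / M) ^+ N / m * `|u' - u|.
Proof.
move=> m0 mM /andP[mu uM] /andP[mu' uM'].
have M0 : 0 < M by exact: lt_le_trans mM.
have [|||c /andP[c1 c2] ->] := @MVT_pos (log_remainder M N)
    (fun u => (1 - u / M) ^+ N / u) u u'.
- by move=> x x0; exact: is_derive_log_remainder.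
- exact: lt_le_trans mu.
- exact: lt_le_trans mu'.
have mc : m <= c by rewrite (le_trans _ c1)// le_min mu mu'.
have cM : c <= M by rewrite (le_trans c2)// ge_max uM uM'.
have c0 : 0 < c by exact: lt_le_trans mc.
have w0 : 0 <= 1 - c / M by rewrite subr_ge0 ler_pdivrMr// mul1r.
rewrite normrM ler_wpM2r// ger0_norm; last first.
  by rewrite divr_ge0 ?exprn_ge0// ltW.
rewrite ler_pM ?exprn_ge0//.
- by rewrite invr_ge0 ltW.
- by rewrite lerXn2r ?nnegrE// ?lerD2l ?lerN2 ?ler_pM2r ?invr_gt0//
     subr_ge0 ler_pdivrMr// mul1r.
- by rewrite lef_pV2.
Qed.

(** Strong concavity: on [0 < u <= M] the second derivative of [ln] is at most [- 1 / M ^ 2]. *)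
Lemma ln_quadratic_bound (M u u' : R) : 0 < u -> u <= M -> 0 < u' -> u' <= M ->
  ln u - ln u' <= (u - u') / u' - (u - u') ^+ 2 / (2 * M ^+ 2).
Proof.
move=> u0 uM u'0 u'M; have M0 : 0 < M by exact: lt_le_trans uM.
pose F : R -> R := @ln R + ((2 * M ^+ 2)^-1 *: (id - cst u') ^+ 2) - (u'^-1 *: id).
have dF (x : R) : 0 < x -> is_derive x (1 : R) F (x^-1 + (x - u') / M ^+ 2 - u'^-1).
  move=> x0.
  have d1 : is_derive x 1 (id - cst u' : R -> R) (1 - 0) by exact: is_deriveB.
  have -> : x^-1 + (x - u') / M ^+ 2 - u'^-1 = x^-1 +
     (2 * M ^+ 2)^-1 *: ((2%:R * (id - cst u' : R -> R) x ^+ 1) *: (1 - 0))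
     - u'^-1 *: 1.
    rewrite !fctE /= /GRing.scale /= expr1 subr0 !mulr1; congr (_ + _ - _).
    by field; rewrite gt_eqF.
  apply: is_deriveB; apply: is_deriveD; exact: is_derive1_ln.
have [c /andP[c1 c2] E] := MVT_pos _ _ _ _ dF u'0 u0.
suff : F u - F u' <= 0.
  rewrite /F !fctE /= /GRing.scale /= subrr expr0n /= mulr0 addr0.
  rewrite mulrBl divff ?gt_eqF// mulVf ?gt_eqF//; lra.
have c0 : 0 < c by apply: lt_le_trans c1; rewrite lt_min u0 u'0.
have cM : c <= M by rewrite (le_trans c2)// ge_max uM u'M.
have -> : F u - F u' = ((c * u')^-1 - (M ^+ 2)^-1) * - ((c - u') * (u - u')).
  by rewrite E; field; rewrite !gt_eqF.
rewrite mulr_ge0_le0//.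
  rewrite subr_ge0 lef_pV2 ?posrE ?mulr_gt0 ?exprn_gt0// expr2 ler_pM// ltW//.
rewrite oppr_le0; move: c1 c2; rewrite /Num.min /Num.max.
case: ltP => h c1 c2; first by apply: mulr_ge0; lra.
by apply: mulr_le0; lra.
Qed.

Lemma exprn_diff (a b : R) (k : nat) :
  a ^+ k.+1 - b ^+ k.+1 = (a - b) * \sum_(i < k.+1) (a ^+ (k - i) * b ^+ i).
Proof. by rewrite subrXX; congr (_ * _); apply: eq_bigr => i _; rewrite subSS. Qed.

Lemma sum_geometric_derivative (r : R) (N : nat) : 0 <= r -> r < 1 ->
  \sum_(k < N) (k.+1%:R * r ^+ k) <= (1 - r) ^- 2.
Proof.
move=> r0 r1.
have E : (1 - r) ^+ 2 * \sum_(k < N) (k.+1%:R * r ^+ k) =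
    1 - (N%:R * (1 - r) + 1) * r ^+ N.
  elim: N => [|N IH]; first by rewrite big_ord0 expr0 mul0r add0r !mulr1 mulr0 subrr.
  rewrite big_ord_recr /= mulrDr IH (exprS r) -natr1; ring.
have r1' : 0 < 1 - r by lra.
rewrite -(ler_pM2l (exprn_gt0 2 r1')) E divff ?expf_neq0 ?gt_eqF// gerBl.
by rewrite mulr_ge0 ?exprn_ge0// addr_ge0// mulr_ge0// ltW.
Qed.

End LogExpansion.

(** * Deviation of log-likelihood ratios of mixtures *)

Section Simplex.
Context {R : realType} {K : nat}.

Lemma simplex_sum (pi : 'cV[R]_K) : simplex pi -> \sum_j pi j 0 = 1.
Proof. by case. Qed.

Lemma simplex_ge0 (pi : 'cV[R]_K) j : simplex pi -> 0 <= pi j 0.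
Proof. by case=> /(_ j) /andP[]. Qed.

End Simplex.

Lemma mixture_bound {d : measure_display} {T : measurableType d} {R : realType}
    {K : nat} (f : 'I_K -> T -> R) (m M : R) (pi : 'cV[R]_K) (y : T) :
  (forall k y, m <= f k y <= M) -> simplex pi -> m <= mixture f pi y <= M.
Proof.
move=> fb spi; rewrite /mixture.
rewrite -[m]mul1r -[M]mul1r -(simplex_sum _ spi) !mulr_suml.
by apply/andP; split; apply: ler_sum => j _; rewrite ler_wpM2l ?simplex_ge0//;
  case/andP: (fb j y).
Qed.

Section DictionaryDeviation.
Context {d : measure_display} {T : measurableType d} {R : realType}.
Variables (K : nat) (f : 'I_K -> T -> R) (m M : R).
Hypothesis m0 : 0 < m.
Hypothesis mM : m <= M.
Hypothesis fb : forall k y, m <= f k y <= M.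
Hypothesis mf : forall k, measurable_fun [set: T] (f k).

Let M0 : 0 < M. Proof. exact: lt_le_trans mM. Qed.

Let r0 : 0 <= 1 - m / M.
Proof. by rewrite subr_ge0 ler_pdivrMr// mul1r. Qed.

Let r1 : 1 - m / M < 1.
Proof. by rewrite gtrBl divr_gt0. Qed.

(** The monomials [(f_l / M) * \prod_(i < k) (1 - f_(s i) / M)], with values
    between 0 and [(1 - m / M) ^ k] if all [f_j] are between [m] and [M]. There are [K ^ k.+1] of them for each [k]. *)
Definition dictionary_monomial (k : nat) (l : 'I_K) (s : {ffun 'I_k -> 'I_K})
    (y : T) : R :=
  f l y / M * \prod_(i < k) (1 - f (s i) y / M).

Lemma bounded_measurable_dictionary k : bounded_measurable (f k).
Proof.
split => //; exists M => y; have /andP[h1 h2] := fb k y.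
by rewrite ger0_norm// (le_trans (ltW m0)).
Qed.

Let bf := bounded_measurable_dictionary.

Lemma bounded_measurable_mixture pi : bounded_measurable (mixture f pi).
Proof.
apply: bounded_measurable_sum => j; apply: bounded_measurableZ; exact: bf.
Qed.

Let bw (h : T -> R) : bounded_measurable h ->
  bounded_measurable (fun y => 1 - h y / M).
Proof.
move=> bh; apply: bounded_measurableB; first exact: bounded_measurable_cst.
by apply: bounded_measurableM => //; exact: bounded_measurable_cst.
Qed.

Lemma bounded_measurable_monomial k l s :
  bounded_measurable (@dictionary_monomial k l s).
Proof.
apply: bounded_measurableM.
  by apply: bounded_measurableM => //; exact: bounded_measurable_cst.
by apply: bounded_measurable_prod => i; exact: bw.
Qed.

Lemma dictionary_monomial_bound k l s y :
  0 <= @dictionary_monomial k l s y <= (1 - m / M) ^+ k.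
Proof.
have /andP[h1 h2] := fb l y.
have h3 : 0 <= f l y / M by rewrite divr_ge0 ?(le_trans (ltW m0))// ltW.
have h4 : f l y / M <= 1 by rewrite ler_pdivrMr// mul1r.
have H i : 0 <= 1 - f (s i) y / M <= 1 - m / M.
  have /andP[h5 h6] := fb (s i) y.
  by rewrite subr_ge0 ler_pdivrMr// mul1r h6/= lerD2l lerN2 ler_pM2r ?invr_gt0.
have p0 : 0 <= \prod_(i < k) (1 - f (s i) y / M).
  by apply: prodr_ge0 => i _; case/andP: (H i).
rewrite mulr_ge0//= -[leRHS]mul1r ler_pM// -[k in leRHS]card_ord -prodr_const.
by apply: ler_prod.
Qed.

Lemma mixtureB pi pi' y :
  mixture f pi' y - mixture f pi y = \sum_j (pi' - pi) j 0 * f j y.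
Proof.
by rewrite /mixture -sumrB; apply: eq_bigr => j _; rewrite !mxE mulrBl.
Qed.

Lemma one_sub_mixture pi y : simplex pi ->
  1 - mixture f pi y / M = \sum_j pi j 0 * (1 - f j y / M).
Proof.
move=> spi; under eq_bigr do rewrite mulrBr mulr1.
rewrite sumrB simplex_sum// /mixture mulr_suml; congr (_ - _).
by apply: eq_bigr => j _; rewrite mulrA.
Qed.

Variables (n : nat) (x : 'I_n -> T) (Q : probability T R).
Hypothesis n0 : (0 < n)%N.
Local Notation dev := (empirical_deviation n x Q).

Variables (N : nat) (tau : R).
Hypothesis tau0 : 0 <= tau.
Hypothesis monomial_dev : forall k l s, (k < N)%N ->
  `|dev (@dictionary_monomial k l s)| <= (1 - m / M) ^+ k * (k.+1%:R * tau).

(** On the simplex [1 - f_pi / M] is a convex combination of the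
    [1 - f_j / M], hence a product of such factors is a convex combination of
    monomials, and linearity transfers the bound. No supremum over the simplex
    is involved. *)
Lemma mixture_product_deviation k l (p : 'I_k -> 'cV[R]_K) : (k < N)%N ->
  (forall i, simplex (p i)) ->
  `|dev (fun y => f l y / M * \prod_(i < k) (1 - mixture f (p i) y / M))| <=
    (1 - m / M) ^+ k * (k.+1%:R * tau).
Proof.
move=> kN sp.
pose F (s : {ffun 'I_k -> 'I_K}) y :=
  (\prod_(i < k) p i (s i) 0) * dictionary_monomial k l s y.
rewrite (_ : (fun y => _) = (fun y => \sum_s F s y)); last first.
  apply/funext => y; under eq_bigr do rewrite one_sub_mixture//.
  rewrite bigA_distr_bigA mulr_sumr; apply: eq_bigr => s _.
  by rewrite /F /dictionary_monomial big_split/=; ring.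
rewrite empirical_deviation_sum; last first.
  by move=> s; apply: bounded_measurableZ; exact: bounded_measurable_monomial.
rewrite (le_trans (ler_norm_sum _ _ _))//.
have <- : \sum_(s : {ffun 'I_k -> 'I_K}) (\prod_(i < k) p i (s i) 0 *
    ((1 - m / M) ^+ k * (k.+1%:R * tau))) = (1 - m / M) ^+ k * (k.+1%:R * tau).
  rewrite -mulr_suml -(bigA_distr_bigA (fun i j => p i j 0)) big1 ?mul1r//.
  by move=> i _; rewrite simplex_sum.
apply: ler_sum => s _.
rewrite /F empirical_deviationZ; last exact: bounded_measurable_monomial.
have p0 : 0 <= \prod_(i < k) p i (s i) 0.
  by apply: prodr_ge0 => i _; exact: simplex_ge0.
by rewrite normrM ger0_norm// ler_wpM2l//; exact: monomial_dev.
Qed.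

(** A product whose factors are [b] up to index [i] and [a] from there on. *)
Lemma prod_switch (a b : R) (i k : nat) : (i <= k)%N ->
  \prod_(j < k) (if (j < i)%N then b else a) = a ^+ (k - i) * b ^+ i.
Proof.
move=> ik; rewrite -(big_mkord xpredT (fun j => if (j < i)%N then b else a)).
rewrite (big_cat_nat (n := i))//= mulrC; congr (_ * _).
  rewrite (@eq_big_nat _ _ _ _ _ _ (fun=> a)).
    by rewrite prodr_const_nat.
  by move=> j /andP[ij _]; rewrite ltnNge ij.
rewrite (@eq_big_nat _ _ _ _ _ _ (fun=> b)).
  by rewrite prodr_const_nat subn0.
by move=> j /andP[_ ->].
Qed.

(** Factoring [a ^ k.+1 - b ^ k.+1] by [a - b], which is linear in [pi' - pi],
    gives the factor [l1norm (pi' - pi)]. *)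
Lemma power_deviation k pi pi' : (k < N)%N -> simplex pi -> simplex pi' ->
  `|dev (fun y => (1 - mixture f pi y / M) ^+ k.+1 -
                  (1 - mixture f pi' y / M) ^+ k.+1)| <=
  k.+1%:R * (l1norm (pi' - pi) * ((1 - m / M) ^+ k * (k.+1%:R * tau))).
Proof.
move=> kN spi spi'.
pose p (i : 'I_k.+1) (j : 'I_k) := if (j < i)%N then pi' else pi.
pose F i l y := f l y / M * \prod_(j < k) (1 - mixture f (p i j) y / M).
have bF i l : bounded_measurable (F i l).
  apply: bounded_measurableM.
    by apply: bounded_measurableM => //; exact: bounded_measurable_cst.
  by apply: bounded_measurable_prod => j; apply: bw; exact: bounded_measurable_mixture.
rewrite (_ : (fun y => _) =
    (fun y => \sum_(i < k.+1) \sum_l (pi' - pi) l 0 * F i l y)); last first.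
  apply/funext => y; rewrite exprn_diff mulr_sumr; apply: eq_bigr => i _.
  rewrite -prod_switch; last by rewrite -ltnS.
  have -> : 1 - mixture f pi y / M - (1 - mixture f pi' y / M) =
      (mixture f pi' y - mixture f pi y) / M by rewrite mulrBl; ring.
  rewrite mixtureB; set A := \prod_(j < k) _.
  rewrite !mulr_suml; apply: eq_bigr => l _.
  rewrite /F !mulrA; congr (_ * _); apply: eq_bigr => j _.
  by rewrite /p; case: (j < i)%N.
rewrite empirical_deviation_sum; last first.
  by move=> i; apply: bounded_measurable_sum => l; exact: bounded_measurableZ.
rewrite (le_trans (ler_norm_sum _ _ _))//.
set B := l1norm _ * _.
have -> : k.+1%:R * B = \sum_(i < k.+1) B.
  by rewrite sumr_const card_ord mulr_natl.
apply: ler_sum => i _; rewrite /B.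
rewrite empirical_deviation_sum; last by move=> l; exact: bounded_measurableZ.
rewrite (le_trans (ler_norm_sum _ _ _))// /l1norm mulr_suml.
apply: ler_sum => l _; rewrite empirical_deviationZ// normrM ler_wpM2l//.
apply: (mixture_product_deviation k l (p i) kN) => j.
by rewrite /p; case: ifP.
Qed.

Lemma bounded_measurable_ln_mixture pi : simplex pi ->
  bounded_measurable (fun y => ln (mixture f pi y)).
Proof.
move=> spi; split.
  have mmix := (bounded_measurable_mixture pi).1.
  by apply: (measurableT_comp (f := @ln R)) => //; exact: measurable_ln.
exists (`|ln m| + `|ln M|) => y; have /andP[h1 h2] := mixture_bound f m M pi y fb spi.
have g0 : 0 < mixture f pi y by exact: lt_le_trans h1.
have h3 : ln m <= ln (mixture f pi y) by rewrite ler_ln ?posrE.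
have h4 : ln (mixture f pi y) <= ln M by rewrite ler_ln ?posrE.
have := ler_norm (ln M); have := ler_norm (- ln m); rewrite normrN => h5 h6.
have := normr_ge0 (ln M); have := normr_ge0 (ln m) => h7 h8.
by rewrite ler_norml; apply/andP; split; lra.
Qed.

(** Deviation of a log-likelihood ratio, uniformly in both mixtures: the Taylor
    polynomial contributes at most [l1norm (pi' - pi)] times
    [tau * \sum_k k.+1 * (1 - m / M) ^ k <= tau * (M / m) ^ 2], and the
    remainder at most twice its sup norm. *)
Lemma log_mixture_deviation pi pi' : simplex pi -> simplex pi' ->
  `|dev (fun y => ln (mixture f pi' y) - ln (mixture f pi y))| <=
  (tau * (M / m) ^+ 2 + 2 * (1 - m / M) ^+ N * (M / m)) * l1norm (pi' - pi).
Proof.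
move=> spi spi'.
pose G k y := (1 - mixture f pi y / M) ^+ k.+1 -
              (1 - mixture f pi' y / M) ^+ k.+1.
pose S y := \sum_(k < N) (k.+1%:R^-1 * G k y).
pose D y := log_remainder M N (mixture f pi' y) -
            log_remainder M N (mixture f pi y).
have bG k : bounded_measurable (G k).
  have bpow p : bounded_measurable (fun y => (1 - mixture f p y / M) ^+ k.+1).
    rewrite (_ : (fun y => _) =
        (fun y => \prod_(i < k.+1) (1 - mixture f p y / M))); last first.
      by apply/funext => y; rewrite prodr_const card_ord.
    apply: bounded_measurable_prod => i; apply: bw.
    exact: bounded_measurable_mixture.
  exact: bounded_measurableB.
have bS : bounded_measurable S.
  by apply: bounded_measurable_sum => k; exact: bounded_measurableZ.
have bL : bounded_measurable (fun y => ln (mixture f pi' y) - ln (mixture f pi y)).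
  by apply: bounded_measurableB; exact: bounded_measurable_ln_mixture.
have DE : D = (fun y => (ln (mixture f pi' y) - ln (mixture f pi y)) + -1 * S y).
  apply/funext => y; rewrite /D /S /log_remainder mulN1r.
  rewrite (_ : \sum_(k < N) k.+1%:R^-1 * G k y =
    \sum_(k < N) (k.+1%:R^-1 * (1 - mixture f pi y / M) ^+ k.+1) -
    \sum_(k < N) (k.+1%:R^-1 * (1 - mixture f pi' y / M) ^+ k.+1)); last first.
    by rewrite -sumrB; apply: eq_bigr => k _; rewrite mulrBr.
  ring.
have bD : bounded_measurable D.
  rewrite DE; apply: bounded_measurableD => //; exact: bounded_measurableZ.
rewrite (_ : (fun y => _) = (fun y => S y + D y)); last first.
  by apply/funext => y; rewrite DE; ring.
rewrite empirical_deviationD// (le_trans (ler_normD _ _))// mulrDl lerD//.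
  rewrite empirical_deviation_sum; last by move=> k; exact: bounded_measurableZ.
  rewrite (le_trans (ler_norm_sum _ _ _))//.
  apply: (@le_trans _ _ (\sum_(k < N)
      (l1norm (pi' - pi) * tau) * (k.+1%:R * (1 - m / M) ^+ k))).
    apply: ler_sum => k _; rewrite empirical_deviationZ//.
    rewrite normrM gtr0_norm ?invr_gt0 ?ltr0n//.
    rewrite ler_pdivrMl ?ltr0n//.
    rewrite (le_trans (power_deviation _ _ _ _ spi spi'))//.
    by rewrite le_eqVlt; apply/orP; left; apply/eqP; ring.
  rewrite -mulr_sumr.
  have -> : tau * (M / m) ^+ 2 * l1norm (pi' - pi) =
      l1norm (pi' - pi) * tau * (M / m) ^+ 2 by ring.
  rewrite ler_wpM2l//.
    by rewrite mulr_ge0// sumr_ge0.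
  rewrite (le_trans (sum_geometric_derivative _ _ r0 r1))//.
  by rewrite opprB addrCA subrr addr0 -exprVn invf_div.
have Db y : `|D y| <= (1 - m / M) ^+ N * (M / m) * l1norm (pi' - pi).
  have H1 := mixture_bound f m M pi y fb spi; have H2 := mixture_bound f m M pi' y fb spi'.
  rewrite (le_trans (log_remainder_lipschitz _ _ N _ _ m0 mM H1 H2))//.
  have H : `|mixture f pi' y - mixture f pi y| <= M * l1norm (pi' - pi).
    rewrite mixtureB (le_trans (ler_norm_sum _ _ _))// /l1norm mulr_sumr.
    apply: ler_sum => l _; rewrite normrM mulrC ler_wpM2r//.
    by have /andP[h1 h2] := fb l y; rewrite ger0_norm// (le_trans (ltW m0)).
  have -> : (1 - m / M) ^+ N * (M / m) * l1norm (pi' - pi) =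
      (1 - m / M) ^+ N / m * (M * l1norm (pi' - pi)) by ring.
  by rewrite ler_wpM2l// divr_ge0 ?exprn_ge0// ltW.
set B := _ * l1norm _ in Db.
have Db' y : - B <= D y <= B by rewrite -ler_norml.
rewrite (le_trans (empirical_deviation_le_bound _ _ _ _ _ _ n0 bD Db'))//.
by rewrite le_eqVlt /B; apply/orP; left; apply/eqP; ring.
Qed.

End DictionaryDeviation.

(** * The event of small deviations *)

Lemma Boole_inequality {d : measure_display} {T : measurableType d}
    {R : realType} (P : {measure set T -> \bar R}) (I : Type) (r : seq I)
    (A : I -> set T) : (forall i, measurable (A i)) ->
  (P (\big[setU/set0]_(i <- r) A i) <= \sum_(i <- r) P (A i))%E.
Proof.
move=> mA; elim: r => [|i r IH]; first by rewrite !big_nil measure0.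
rewrite !big_cons (le_trans (measureU2 _ _ _))//; last exact: leeD.
exact: bigsetU_measurable.
Qed.

Section GoodEvent.
Context {d d' : measure_display} {Omega : measurableType d}
  {T : measurableType d'} {R : realType} {P : probability Omega R}.
Variables (n : nat) (X : 'I_n -> {RV P >-> T}) (Q : probability T R).
Hypothesis n0 : (0 < n)%N.
Hypothesis indepX : mutually_independent X.
Hypothesis lawX : forall i h, bounded_measurable h ->
  \int[P]_w h (X i w) = \int[Q]_y h y.

Local Notation dev h w := (empirical_deviation n (fun i => X i w) Q h).

Lemma Hoeffding_scaled h (b t : R) : bounded_measurable h ->
  (forall y, 0 <= h y <= b) -> 0 <= b -> 0 <= t ->
  (P [set w | (b * t < `|dev h w|)%R] <= (2 * expR (- (n%:R * t ^+ 2 / 8)))%:E)%E.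
Proof.
move=> bh hb; rewrite le_eqVlt => /predU1P[b0|b0] t0.
  rewrite (_ : [set w | _] = set0); first by rewrite measure0 lee_fin mulr_ge0// expR_ge0.
  apply/seteqP; split=> w //=; rewrite -b0 mul0r => H.
  have := empirical_deviation_le_bound n (fun i => X i w) Q _ _ _ n0 bh hb.
  by rewrite -b0 subr0 leNgt H.
have bh' : bounded_measurable (fun y => b^-1 * h y) by exact: bounded_measurableZ.
have := Hoeffding n X Q n0 indepX lawX _ t bh' _ t0.
rewrite (_ : [set w | t < _] = [set w | b * t < `|dev h w|]); last first.
  apply/seteqP; split=> w /=; rewrite empirical_deviationZ// normrM gtr0_norm ?invr_gt0//;
  by rewrite ltr_pdivlMl.
apply => y; have /andP[h0 h1] := hb y.
by rewrite mulr_ge0 ?invr_ge0 ?(ltW b0)//= ler_pdivrMl// mulr1.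
Qed.

Variables (K : nat) (f : 'I_K -> T -> R) (m M : R).
Hypothesis K4 : (4 <= K)%N.
Hypothesis m0 : 0 < m.
Hypothesis mM : m <= M.
Hypothesis fb : forall k y, m <= f k y <= M.
Hypothesis mf : forall k, measurable_fun [set: T] (f k).

(** With [x = K (delta / K) ^ 2 <= delta / 8], some monomial of order [k]
    violates its bound with probability at most [2 x ^ k.+1], and
    [2 \sum_k x ^ k.+1 <= delta]. *)
Lemma monomial_deviation_event (delta : R) (N : nat) : 0 < delta < 2^-1 ->
  exists E : set Omega, [/\ measurable E, ((1 - delta)%:E <= P E)%E &
    forall w, E w -> forall k l s, (k < N)%N ->
      `|dev (dictionary_monomial K f M k l s) w| <=
        (1 - m / M) ^+ k * (k.+1%:R * (4 * Num.sqrt (ln (K%:R / delta) / n%:R)))].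
Proof.
move=> /andP[d0 d2].
have M0 : 0 < M by exact: lt_le_trans mM.
have r0 : 0 <= 1 - m / M by rewrite subr_ge0 ler_pdivrMr// mul1r.
have K4' : 4 <= K%:R :> R by rewrite (ler_nat R 4).
have n0' : 0 < n%:R :> R by rewrite ltr0n.
set L := ln (K%:R / delta).
have Kd : 1 <= K%:R / delta by rewrite ler_pdivlMr// mul1r; lra.
have L0 : 0 <= L by exact: ln_ge0.
set tau : R := 4 * _.
have tau0 : 0 <= tau by rewrite mulr_ge0// sqrtr_ge0.
have tau2 : n%:R * tau ^+ 2 = 16 * L.
  rewrite exprMn sqr_sqrtr ?divr_ge0 ?(ltW n0')//.
  by field; rewrite gt_eqF.
pose I := {k : 'I_N & ('I_K * {ffun 'I_k -> 'I_K})%type}.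
pose h (i : I) := dictionary_monomial K f M (tag i) (tagged i).1 (tagged i).2.
have bh i : bounded_measurable (h i).
  exact: (bounded_measurable_monomial K f m M m0 fb mf).
pose t (i : I) := (tag i).+1%:R * tau.
pose Bad (i : I) := [set w | (1 - m / M) ^+ (tag i) * t i < `|dev (h i) w|].
have mBad i : measurable (Bad i) by exact: measurable_deviation_gt.
pose x := K%:R * (delta / K%:R) ^+ 2.
have x0 : 0 <= x by rewrite mulr_ge0// sqr_ge0.
have xd : x <= delta / 8.
  have -> : x = delta * (delta / K%:R) by rewrite /x; field; rewrite gt_eqF//; lra.
  rewrite ler_wpM2l ?(ltW d0)// ler_pdivrMr; last lra.
  have : 8^-1 * 4 <= 8^-1 * K%:R :> R by rewrite ler_wpM2l.
  lra.
have PBad i : (P (Bad i) <= (2 * ((delta / K%:R) ^+ 2) ^+ (tag i).+1)%:E)%E.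
  have := Hoeffding_scaled _ _ (t i) (bh i)
    (dictionary_monomial_bound K f m M m0 mM fb _ _ _) (exprn_ge0 _ r0).
  move=> /(_ (mulr_ge0 (ler0n _ _) tau0)) /le_trans; apply.
  rewrite lee_fin ler_wpM2l//.
  have -> : delta / K%:R = expR (- L).
    rewrite expRN lnK ?invf_div// posrE; apply: lt_le_trans Kd; exact: ltr01.
  rewrite -!expRM_natl ler_expR.
  have -> : n%:R * t i ^+ 2 = (tag i).+1%:R ^+ 2 * (16 * L).
    by rewrite -tau2 /t; ring.
  have k1 : 1 <= (tag i).+1%:R :> R by rewrite ler1n.
  have : 0 <= ((tag i).+1%:R - 1) * ((tag i).+1%:R * L) by rewrite mulr_ge0 ?mulr_ge0//; lra.
  rewrite !expr2; lra.
have mU : measurable (\big[setU/set0]_i Bad i) by exact: bigsetU_measurable.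
exists (~` \big[setU/set0]_i Bad i); split.
- exact: measurableC.
- rewrite probability_setC// EFinB leeB//.
  apply: (le_trans (Boole_inequality _ _ _ _ mBad)).
  apply: (@le_trans _ _ (\sum_(i : I) (2 * ((delta / K%:R) ^+ 2) ^+ (tag i).+1)%:E)%E).
    by apply: lee_sum => i _; exact: PBad.
  rewrite sumEFin lee_fin.
  rewrite -(sig_big_dep xpredT (fun _ _ => true)
    (fun (k : 'I_N) (_ : 'I_K * {ffun 'I_k -> 'I_K}) => 2 * ((delta / K%:R) ^+ 2) ^+ k.+1)).
  have HS (k : 'I_N) : \sum_(j : 'I_K * {ffun 'I_k -> 'I_K})
      (2 * ((delta / K%:R) ^+ 2) ^+ k.+1) = 2 * x ^+ k.+1.
    rewrite sumr_const card_prod card_ffun !card_ord -expnS -[LHS]mulr_natl.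
    by rewrite natrX [x ^+ _]exprMn mulrCA.
  rewrite (eq_bigr _ (fun k _ => HS k)) -mulr_sumr.
  apply: (@le_trans _ _ (2 * (delta / 4))); last lra.
  rewrite ler_wpM2l//.
  (* The subtracted term makes the induction go through. *)
  suff H N' : \sum_(k < N') x ^+ k.+1 <= delta / 4 - 2 * x ^+ N'.+1.
    by rewrite (le_trans (H N))// gerBl mulr_ge0// exprn_ge0.
  have xle : 2 * x <= 1 by lra.
  elim: N' => [|N' IH]; first by rewrite big_ord0 expr1; lra.
  rewrite big_ord_recr/=.
  have : x ^+ N'.+1 * (2 * x) <= x ^+ N'.+1 * 1 by rewrite ler_wpM2l// exprn_ge0.
  rewrite (exprSr x N'.+1) => h1; lra.
- move=> w Ew k l s kN.
  rewrite leNgt; apply/negP => H; apply: Ew.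
  rewrite -bigcup_seq.
  exists (Tagged (fun k : 'I_N => ('I_K * {ffun 'I_k -> 'I_K})%type)
            (i := Ordinal kN) (l, s)) => //=.
  by rewrite mem_index_enum.
Qed.

End GoodEvent.

(** * Curvature of the likelihood at its maximizer *)

Lemma le0_of_le_scaled {R : realType} (a C : R) :
  (forall s, 0 < s < 1 -> a <= s * C) -> a <= 0.
Proof.
move=> H; rewrite leNgt; apply/negP => a0.
have D0 : 0 < a + `|C| + 1 by rewrite ltr_wpDl// addr_ge0// ltW.
have : a <= a / (a + `|C| + 1) * `|C|.
  have s01 : 0 < a / (a + `|C| + 1) < 1.
    rewrite divr_gt0//= ltr_pdivrMr// mul1r; have := normr_ge0 C; lra.
  apply: le_trans (H _ s01) _; rewrite ler_wpM2l ?ler_norm//.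
  by case/andP: s01 => /ltW.
rewrite mulrAC ler_pdivlMr// -subr_ge0 => h.
have : 0 < a * (a + 1) by rewrite mulr_gt0// addr_gt0.
lra.
Qed.

Section Restriction.
Context {R : realType} {K : nat}.
Implicit Types (v pi : 'cV[R]_K) (J : {set 'I_K}).

Lemma l1norm_ge0 v : 0 <= l1norm v.
Proof. by apply: sumr_ge0. Qed.

Lemma l1norm_restr J v : l1norm (restr J v) = \sum_(j in J) `|v j 0|.
Proof.
rewrite /l1norm [RHS]big_mkcond; apply: eq_bigr => j _; rewrite mxE.
by case: ifP; rewrite ?normr0.
Qed.

Lemma l1norm_split J v :
  l1norm v = l1norm (restr J v) + l1norm (restr (~: J) v).
Proof.
rewrite !l1norm_restr /l1norm (bigID (mem J))/=; congr (_ + _).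
by apply: eq_bigl => j; rewrite inE.
Qed.

(** Since the coordinates of [pi' - pi] sum to zero, its mass outside [J] is
    controlled by its mass on [J] and the mass of [pi] outside [J]. *)
Lemma simplex_difference_cone J pi pi' : simplex pi -> simplex pi' ->
  l1norm (restr (~: J) (pi' - pi)) <=
    l1norm (restr J (pi' - pi)) + 2 * l1norm (restr (~: J) pi).
Proof.
move=> spi spi'; rewrite !l1norm_restr.
have S (p : 'cV[R]_K) : simplex p -> \sum_(j in J) p j 0 + \sum_(j in ~: J) p j 0 = 1.
  move=> sp; rewrite -(simplex_sum _ sp) [RHS](bigID (mem J))/=; congr (_ + _).
  by apply: eq_bigl => j; rewrite inE.
have pE : \sum_(j in ~: J) `|pi j 0| = \sum_(j in ~: J) pi j 0.
  by apply: eq_bigr => j _; rewrite ger0_norm// simplex_ge0.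
have h1 : \sum_(j in ~: J) `|(pi' - pi) j 0| <=
    \sum_(j in ~: J) pi' j 0 + \sum_(j in ~: J) pi j 0.
  rewrite -big_split/=; apply: ler_sum => j _; rewrite !mxE.
  by rewrite (le_trans (ler_normB _ _))// !ger0_norm// simplex_ge0.
have h2 : \sum_(j in J) pi j 0 - \sum_(j in J) pi' j 0 <=
    \sum_(j in J) `|(pi' - pi) j 0|.
  rewrite -sumrB; apply: ler_sum => j _; rewrite !mxE distrC; exact: ler_norm.
have := S _ spi; have := S _ spi'; rewrite pE; lra.
Qed.

End Restriction.

Section GramForm.
Context {T : Type} {R : realType} {K n : nat}.
Variables (f : 'I_K -> T -> R) (f0 : T -> R) (x : 'I_n -> T).
Implicit Types v : 'cV[R]_K.

(** The quadratic form of the empirical Gram matrix of the functions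
    [f j - f0]. *)
Definition gram_form v : R :=
  n%:R^-1 * \sum_i (\sum_j v j 0 * (f j (x i) - f0 (x i))) ^+ 2.

Lemma gram_form_ge0 v : 0 <= gram_form v.
Proof. by rewrite mulr_ge0// sumr_ge0// => i _; exact: sqr_ge0. Qed.

Lemma gram_formE v : (v^T *m gram f f0 x *m v) 0 0 = gram_form v.
Proof.
rewrite mxE /gram_form.
transitivity (\sum_l \sum_k \sum_i n%:R^-1 *
   ((v k 0 * (f k (x i) - f0 (x i))) * (v l 0 * (f l (x i) - f0 (x i))))).
  apply: eq_bigr => l _; rewrite mxE mulr_suml; apply: eq_bigr => k _.
  rewrite !mxE !mulr_sumr mulr_suml; apply: eq_bigr => i _; ring.
rewrite mulr_sumr.
rewrite (eq_bigr (fun l => \sum_i \sum_k n%:R^-1 *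
   ((v k 0 * (f k (x i) - f0 (x i))) * (v l 0 * (f l (x i) - f0 (x i)))))).
  rewrite exchange_big/=; apply: eq_bigr => i _.
  rewrite expr2 mulr_sumr mulr_sumr; apply: eq_bigr => l _.
  by rewrite mulr_suml mulr_sumr.
by move=> l _; rewrite exchange_big.
Qed.

(** Only this inequality is needed, so that the existence of a positive
    semidefinite square root plays no role: for the default value 0 of
    [sqrtmx] the left-hand side vanishes. *)
Lemma l2norm_sqrtmx_le v :
  l2norm (sqrtmx (gram f f0 x) *m v) ^+ 2 <= gram_form v.
Proof.
rewrite /l2norm sqr_sqrtr; last by apply: sumr_ge0 => j _; exact: sqr_ge0.
rewrite /sqrtmx; case: xgetP => [B _ [[BT _] BB]|_]; last first.
  rewrite big1 ?gram_form_ge0// => j _.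
  by rewrite mul0mx mxE expr0n.
rewrite le_eqVlt; apply/orP; left; apply/eqP.
rewrite -gram_formE -BB.
have -> : v^T *m (B *m B) *m v = (B *m v)^T *m (B *m v).
  by rewrite trmx_mul BT !mulmxA.
by rewrite [RHS]mxE; apply: eq_bigr => j _; rewrite [in RHS]mxE expr2.
Qed.

(** Continuity of the quadratic form along a segment, with an explicit linear modulus. *)
Lemma gram_form_perturb v w : exists2 C, 0 <= C &
  forall s, 0 < s < 1 -> gram_form (v + s *: w) <= gram_form v + s * C.
Proof.
pose p i := \sum_j v j 0 * (f j (x i) - f0 (x i)).
pose q i := \sum_j w j 0 * (f j (x i) - f0 (x i)).
exists (n%:R^-1 * \sum_i (2 * `|p i * q i| + q i ^+ 2)).
  by rewrite mulr_ge0// sumr_ge0// => i _; rewrite addr_ge0 ?sqr_ge0// mulr_ge0.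
move=> s /andP[s0 s1]; rewrite /gram_form mulrCA -mulrDr ler_wpM2l//.
rewrite mulr_sumr -big_split/=; apply: ler_sum => i _.
have -> : \sum_j (v + s *: w) j 0 * (f j (x i) - f0 (x i)) = p i + s * q i.
  rewrite /p /q mulr_sumr -big_split/=; apply: eq_bigr => j _; rewrite !mxE; ring.
rewrite -/(p i).
have h1 : s * (p i * q i) <= s * `|p i * q i| by rewrite ler_wpM2l ?ler_norm// ltW.
have h2 : s * (s * q i ^+ 2) <= s * (1 * q i ^+ 2).
  by rewrite ler_wpM2l ?(ltW s0)// ler_wpM2r ?sqr_ge0// ltW.
rewrite sqrrD; move: h1 h2; rewrite !expr2 mulr2n; lra.
Qed.

End GramForm.

Section MaximumLikelihood.
Context {d : measure_display} {T : measurableType d} {R : realType} {K n : nat}.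
Variables (f : 'I_K -> T -> R) (m M : R) (x : 'I_n -> T).
Hypothesis m0 : 0 < m.
Hypothesis mM : m <= M.
Hypothesis fb : forall k y, m <= f k y <= M.
Hypothesis n0 : (0 < n)%N.

Lemma mle_loglik_le pihat pi : is_mle f x pihat -> simplex pi ->
  \sum_i ln (mixture f pi (x i)) <= \sum_i ln (mixture f pihat (x i)).
Proof.
move=> [_ /(_ pi)] H /H; rewrite /neg_loglik lerN2 ler_pM2l//.
by rewrite invr_gt0 ltr0n.
Qed.

(** First-order optimality: the directional derivative of the log-likelihood
    from the maximizer [pihat] towards [pi] is nonpositive. It is obtained from
    [1 - 1 / t <= ln t] along the segment, letting [s] tend to 0. *)
Lemma mle_first_order pihat pi : is_mle f x pihat -> simplex pi ->
  \sum_i (mixture f pi (x i) - mixture f pihat (x i)) / mixture f pihat (x i) <= 0.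
Proof.
move=> mle spi; have sph := mle.1.
pose u i := mixture f pi (x i); pose u' i := mixture f pihat (x i).
pose y i := (u i - u' i) / u' i.
apply: (@le0_of_le_scaled _ _ (\sum_i (y i ^+ 2 * (M / m)))) => s /andP[s0 s1].
pose pis := pihat + s *: (pi - pihat).
have pisE j : pis j 0 = (1 - s) * pihat j 0 + s * pi j 0.
  by rewrite /pis !mxE; ring.
have spis : simplex pis.
  have Spis : \sum_j pis j 0 = 1.
    under eq_bigr do rewrite pisE.
    rewrite big_split/= -!mulr_sumr !simplex_sum//; lra.
  split => // j.
  have ge0 k : 0 <= pis k 0.
    have h1 := simplex_ge0 pihat k sph; have h2 := simplex_ge0 pi k spi.
    by rewrite pisE addr_ge0// mulr_ge0//; lra.
  by rewrite ge0/= -Spis (bigD1 j)//= lerDl sumr_ge0.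
have usE i : mixture f pis (x i) = u' i + s * (u i - u' i).
  rewrite /u /u' /mixture; under eq_bigr do rewrite pisE.
  rewrite mulrBr !mulr_sumr -sumrB -big_split/=.
  by apply: eq_bigr => j _; ring.
have H i : y i - s * (y i ^+ 2 * (M / m)) <=
    s^-1 * (ln (mixture f pis (x i)) - ln (mixture f pihat (x i))).
  have /andP[l1 l2] := mixture_bound f m M pihat (x i) fb sph.
  have /andP[l3 l4] := mixture_bound f m M pis (x i) fb spis.
  rewrite -/(u' i) in l1 l2 *.
  have u'0 : 0 < u' i by exact: lt_le_trans l1.
  set us := mixture f pis (x i) in l3 l4 *.
  have us0 : 0 < us by exact: lt_le_trans l3.
  have lnle : ln (u' i) - ln us <= u' i / us - 1.
    rewrite -ln_div ?posrE//.
    have := @le_ln1Dx R (u' i / us - 1).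
    by rewrite addrCA subrr addr0; apply; rewrite ltrBDr addNr divr_gt0.
  rewrite ler_pdivlMl//.
  apply: (@le_trans _ _ (1 - u' i / us)); last lra.
  have usy : us = u' i * (1 + s * y i).
    by rewrite /us usE /y; field; rewrite gt_eqF.
  have w0 : m / M <= 1 + s * y i.
    have -> : 1 + s * y i = us / u' i by rewrite usy mulrAC divff ?mul1r ?gt_eqF.
    rewrite ler_pM// ?invr_ge0 ?(ltW m0)// ?lef_pV2 ?posrE//.
      exact/ltW/lt_le_trans/mM.
    exact: lt_le_trans mM.
  have M0 : 0 < M by exact: lt_le_trans mM.
  have w00 : 0 < 1 + s * y i by apply: lt_le_trans w0; rewrite divr_gt0.
  have -> : 1 - u' i / us = s * (y i - s * (y i ^+ 2 / (1 + s * y i))).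
    by rewrite usy; field; rewrite !gt_eqF.
  rewrite ler_wpM2l ?(ltW s0)// lerD2l lerN2 ler_wpM2l ?(ltW s0)//.
  by rewrite ler_wpM2l ?sqr_ge0// -[leRHS]invf_div lef_pV2 ?posrE ?divr_gt0.
rewrite -subr_le0 mulr_sumr -sumrB.
apply: (@le_trans _ _ (\sum_i s^-1 * (ln (mixture f pis (x i)) - ln (mixture f pihat (x i))))).
  by apply: ler_sum => i _; exact: H.
rewrite -mulr_sumr sumrB pmulr_rle0 ?invr_gt0// subr_le0.
exact: mle_loglik_le.
Qed.

(** The log-likelihood of the maximizer exceeds that of any competitor by a
    quadratic term. The coordinates of [pihat - pi] sum to zero, so the offset
    [f0] disappears from the Gram form. *)
Lemma mle_quadratic_gap f0 pihat pi : is_mle f x pihat -> simplex pi ->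
  gram_form f f0 x (pihat - pi) / (2 * M ^+ 2) <=
    n%:R^-1 * \sum_i (ln (mixture f pihat (x i)) - ln (mixture f pi (x i))).
Proof.
move=> mle spi; have sph := mle.1; have M0 : 0 < M by exact: lt_le_trans mM.
rewrite /gram_form -mulrA ler_wpM2l// mulr_suml.
have H := mle_first_order _ _ mle spi.
rewrite -[leRHS]addr0; apply: le_trans (lerD (lexx _) H).
rewrite -big_split/=; apply: ler_sum => i _.
have /andP[l1 l2] := mixture_bound f m M pihat (x i) fb sph.
have /andP[l3 l4] := mixture_bound f m M pi (x i) fb spi.
have := @ln_quadratic_bound R M (mixture f pi (x i)) (mixture f pihat (x i))
  (lt_le_trans m0 l3) l4 (lt_le_trans m0 l1) l2.
have -> : \sum_j (pihat - pi) j 0 * (f j (x i) - f0 (x i)) =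
   mixture f pihat (x i) - mixture f pi (x i).
  under eq_bigr do rewrite mulrBr.
  rewrite sumrB -mulr_suml -mixtureB.
  have -> : \sum_j (pihat - pi) j 0 = 0.
    by under eq_bigr do rewrite !mxE; rewrite sumrB !simplex_sum// subrr.
  by rewrite mul0r subr0.
rewrite -[(mixture f pihat (x i) - _) ^+ 2]sqrrN opprB; lra.
Qed.

End MaximumLikelihood.

(** * Kullback-Leibler divergences *)

Section LowerBoundedIntegral.
Context {d : measure_display} {T : measurableType d} {R : realType}.
Variables (nu : {measure set T -> \bar R}).
Hypothesis nufin : (nu [set: T] < +oo)%E.

(** The negative part is bounded by [c], hence integrable for a finite measure. *)
Lemma integral_lower_bounded_gtNy (u : T -> R) (c : R) : 0 <= c ->
  measurable_fun [set: T] u -> (forall x, - c <= u x) ->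
  (-oo < \int[nu]_x (u x)%:E)%E.
Proof.
move=> c0 mu uc; rewrite integralE.
have meu : measurable_fun [set: T] (fun x => (u x)%:E) by exact/measurable_EFinP.
have Hneg : (\int[nu]_x ((fun x => (u x)%:E)^\- x) < +oo)%E.
  apply: (@le_lt_trans _ _ (\int[nu]_x (cst c%:E x))%E).
    apply: ge0_le_integral => //.
    - exact: measurable_funeneg.
    - by move=> x _; rewrite funenegE ge_max -EFinN !lee_fin c0 lerNl uc.
  by rewrite integral_cst// lte_mul_pinfty// lee_fin.
have Hneg0 : (0 <= \int[nu]_x ((fun x => (u x)%:E)^\- x))%E by exact: integral_ge0.
have Hpos0 : (0 <= \int[nu]_x ((fun x => (u x)%:E)^\+ x))%E by exact: integral_ge0.
apply: (@lt_le_trans _ _ (- \int[nu]_x ((fun x => (u x)%:E)^\- x))%E).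
  by rewrite ltNye_eq fin_numN ge0_fin_numE// Hneg.
by rewrite -[leLHS]add0e leeD2r.
Qed.

(** If [u] is not integrable, the right-hand side is [+oo]. *)
Lemma le_integralD_lower_bounded (u b : T -> R) (c : R) : 0 <= c ->
  measurable_fun [set: T] u -> (forall x, - c <= u x) ->
  nu.-integrable [set: T] (EFin \o b) ->
  (\int[nu]_x (u x + b x)%:E <= \int[nu]_x (u x)%:E + \int[nu]_x (b x)%:E)%E.
Proof.
move=> c0 mu uc ib.
have bfin : (\int[nu]_x (b x)%:E)%E \is a fin_num by exact: integrable_fin_num.
have := integral_lower_bounded_gtNy u c c0 mu uc.
case E : (\int[nu]_x (u x)%:E)%E => [r| |]// _; last first.
  by rewrite addye ?leey// -ltNye ltNye_eq bfin.
have iu : nu.-integrable [set: T] (EFin \o u).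
  apply/integrableP; split; first exact/measurable_EFinP.
  by rewrite integral_fin_num_abs// E.
by rewrite -E -(integralD_EFin measurableT iu ib).
Qed.

End LowerBoundedIntegral.

Section KullbackLeibler.
Context {d : measure_display} {T : measurableType d} {R : realType}.
Variables (nu : {measure set T -> \bar R}) (fstar : T -> R).
Hypothesis dstar : is_density nu fstar.
Variables (m M : R).
Hypothesis m0 : 0 < m.
Hypothesis mM : m <= M.

(** No convention is involved when the second density is bounded away from 0. *)
Lemma KL_bounded_below_density (g : T -> R) : (forall x, m <= g x) ->
  KL nu fstar g = (\int[nu]_x (fstar x * ln (fstar x) - fstar x * ln (g x))%:E)%E.
Proof.
move=> mg; rewrite /KL.
rewrite (_ : [set x | g x = 0] = set0); last first.
  apply/seteqP; split=> x //= gx0; have := mg x.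
  by rewrite gx0 leNgt m0.
rewrite integral_set0 ltxx; apply: eq_integral => x _; congr EFin.
have [_ f0 _] := dstar.
have := f0 x; rewrite le_eqVlt => /predU1P[<-|fx0]; first by rewrite !mul0r subrr.
by rewrite ln_div ?posrE ?mulrBr//; exact: lt_le_trans (mg x).
Qed.

(** From [f ln (f / g) >= f - g >= - g]. *)
Lemma KL_integrand_ge (g : T -> R) x : (forall x, m <= g x <= M) ->
  - M <= fstar x * ln (fstar x) - fstar x * ln (g x).
Proof.
move=> gb; have [_ f0 _] := dstar; have /andP[mg gM] := gb x.
have M0 : 0 < M by exact: lt_le_trans mM.
have := f0 x; rewrite le_eqVlt => /predU1P[<-|fx0].
  by rewrite !mul0r subrr oppr_le0 ltW.
have gx0 : 0 < g x by exact: lt_le_trans mg.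
have h : ln (g x) - ln (fstar x) <= g x / fstar x - 1.
  rewrite -ln_div ?posrE//.
  have := @le_ln1Dx R (g x / fstar x - 1).
  by rewrite addrCA subrr addr0; apply; rewrite ltrBDr addNr divr_gt0.
have : fstar x * (ln (g x) - ln (fstar x)) <= fstar x * (g x / fstar x - 1).
  by rewrite ler_pM2l.
rewrite [leRHS](_ : _ = g x - fstar x); last by field; rewrite gt_eqF.
lra.
Qed.

Lemma measurable_KL_integrand (g : T -> R) : measurable_fun [set: T] g ->
  measurable_fun [set: T] (fun x => fstar x * ln (fstar x) - fstar x * ln (g x)).
Proof.
move=> mg; have [mf _ _] := dstar.
have mln (h : T -> R) : measurable_fun [set: T] h ->
    measurable_fun [set: T] (fun x => ln (h x)).
  by move=> mh; apply: (measurableT_comp (f := @ln R)) => //; exact: measurable_ln.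
by apply: measurable_funB; apply: measurable_funM => //; exact: mln.
Qed.

Hypothesis nufin : (nu [set: T] < +oo)%E.

Lemma KL_gtNy (g : T -> R) : measurable_fun [set: T] g ->
  (forall x, m <= g x <= M) -> (-oo < KL nu fstar g)%E.
Proof.
move=> mg gb; have M0 : 0 < M by exact: lt_le_trans mM.
rewrite KL_bounded_below_density; last by move=> x; case/andP: (gb x).
apply: (integral_lower_bounded_gtNy _ nufin _ _ (ltW M0)).
  exact: measurable_KL_integrand.
by move=> x; exact: KL_integrand_ge.
Qed.

Variable Q : probability T R.
Hypothesis lawQ : forall A, measurable A -> Q A = (\int[nu]_(x in A) (fstar x)%:E)%E.

Lemma integral_density (h : T -> R) : bounded_measurable h ->
  nu.-integrable [set: T] (fun x => (fstar x * h x)%:E) /\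
  (\int[nu]_x (fstar x * h x)%:E = (\int[Q]_x h x)%:E)%E.
Proof.
move=> bh; have [mh [C' hC']] := bh; have [mf f0 f1] := dstar.
pose C := `|C'|; have C0 : 0 <= C by exact: normr_ge0.
have hC x : `|h x| <= C by rewrite (le_trans (hC' x))// ler_norm.
have istar : nu.-integrable [set: T] (EFin \o fstar).
  apply/integrableP; split; first exact/measurable_EFinP.
  rewrite (eq_integral (fun x => (fstar x)%:E)); first by rewrite f1 ltry.
  by move=> x _ /=; rewrite ger0_norm.
have iC : nu.-integrable [set: T] (fun x => (fstar x * C)%:E).
  rewrite (_ : (fun x => _) = (fun x => C%:E * (EFin \o fstar) x)%E).
    exact: integrableZl.
  by apply/funext => x; rewrite mulrC EFinM.
have ih : nu.-integrable [set: T] (fun x => (fstar x * h x)%:E).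
  apply: (le_integrable measurableT _ _ iC).
    by apply/measurable_EFinP; exact: measurable_funM.
  move=> x _; rewrite lee_fin !normrM ler_wpM2l//.
  by rewrite (ger0_norm C0).
split => //.
have bhC : bounded_measurable (fun x => h x + C).
  by apply: bounded_measurableD => //; exact: bounded_measurable_cst.
have hC0 x : 0 <= h x + C.
  by have := hC x; rewrite ler_norml => /andP[? _]; lra.
have HQ A : measurable A -> (\int[nu]_(s in id @^-1` A) (fstar s)%:E = Q A)%E.
  by move=> mA; rewrite lawQ.
have mhC : measurable_fun [set: T] (fun x => (h x + C)%:E).
  by apply/measurable_EFinP; exact: bhC.1.
have hC0' x : (0 <= (h x + C)%:E)%E by rewrite lee_fin.
have := @ge0_integral_weighted_pushforward _ _ _ _ _ nu Q id fstar
  (@measurable_id _ _ _) mf f0 HQ (fun x => (h x + C)%:E) mhC hC0'.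
rewrite EFin_Rintegral// RintegralD//; last 2 first.
- exact: bounded_measurable_integrable.
- exact: (bounded_measurable_integrable Q _ (bounded_measurable_cst C)).
rewrite Rintegral_cst//= probability_setT mulr1 EFinD => E.
have : (\int[nu]_x (fstar x * h x)%:E + C%:E = (\int[Q]_x h x)%:E + C%:E)%E.
  rewrite -E; transitivity (\int[nu]_x ((fstar x * h x)%:E + (fstar x * C)%:E))%E.
    rewrite integralD//; congr (_ + _)%E.
    under eq_integral do rewrite mulrC EFinM.
    by rewrite integralZl// f1 mule1.
  by apply: eq_integral => x _; rewrite -EFinM -EFinD -mulrDr mulrC.
by move/(congr1 (fun z => z - C%:E)%E); rewrite !addeK.
Qed.

Lemma KL_le_add (g g' : T -> R) :
  measurable_fun [set: T] g -> measurable_fun [set: T] g' ->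
  (forall x, m <= g x <= M) -> (forall x, m <= g' x <= M) ->
  bounded_measurable (fun x => ln (g x) - ln (g' x)) ->
  (KL nu fstar g' <=
    KL nu fstar g + (\int[Q]_x (ln (g x) - ln (g' x)))%:E)%E.
Proof.
move=> mg mg' gb g'b bd; have M0 : 0 < M by exact: lt_le_trans mM.
have [ib <-] := integral_density _ bd.
rewrite !KL_bounded_below_density; last 2 first.
- by move=> x; case/andP: (gb x).
- by move=> x; case/andP: (g'b x).
apply: (le_trans _ (le_integralD_lower_bounded _ nufin _ _ _ (ltW M0) _ _ ib)).
- rewrite le_eqVlt; apply/orP; left; apply/eqP; apply: eq_integral => x _.
  by congr EFin; ring.
- exact: measurable_KL_integrand.
- by move=> x; exact: KL_integrand_ge.
Qed.

End KullbackLeibler.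

Lemma density_bounded_below_finite {d : measure_display} {T : measurableType d}
    {R : realType} (nu : {measure set T -> \bar R}) (f : T -> R) (m : R) :
  is_density nu f -> 0 < m -> (forall x, m <= f x) -> (nu [set: T] < +oo)%E.
Proof.
move=> [mf f0 f1] m0 mlef.
have : (m%:E * nu [set: T] <= 1)%E.
  rewrite -f1 -integral_cst//; apply: ge0_le_integral => //.
  - by move=> x _; rewrite lee_fin ltW.
  - exact/measurable_EFinP.
  - by move=> x _; rewrite lee_fin.
case: (nu [set: T]) => [r| |] // H; first by rewrite ltry.
by move: H; rewrite gt0_muley ?lte_fin.
Qed.

(** * Compatibility constants *)

Section CompatibilityTerm.
Context {R : realType}.

(** Dividing [b] by [n] times a compatibility constant: the result is either
    infinite or a real [tau] which turns the infimum into an inequality on the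
    whole cone. When the cone is empty the infimum is [+oo] and [tau = 0]. *)
Lemma div_ereal_inf_cases (V : Type) (cone : set V) (E : V -> R) (b : R) (n : nat) :
  (0 < n)%N -> 0 <= b -> (forall v, cone v -> 0 <= E v) ->
  (forall v, cone v -> 0 < b) ->
  let B := (b%:E / (n%:R%:E * ereal_inf [set (E v)%:E | v in cone]))%E in
  B = +oo%E \/ exists2 tau, 0 <= tau &
    B = tau%:E /\ forall v, cone v -> b <= tau * n%:R * E v.
Proof.
move=> n0 b0 E0 bcone B; rewrite {}/B.
have n0' : 0 < n%:R :> R by rewrite ltr0n.
set kap := ereal_inf _.
have kap_le v : cone v -> (kap <= (E v)%:E)%E.
  by move=> cv; apply: ereal_inf_lbound; exists v.
have : (0 <= kap)%E.
  by apply: le_ereal_inf_tmp => _ [v cv <-]; rewrite lee_fin E0.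
case: kap kap_le => [k| |] kap_le // kap0; last first.
  right; exists 0 => //; split; first by rewrite gt0_muley ?lte_fin// invey mule0.
  by move=> v /kap_le; rewrite leye_eq.
rewrite lee_fin in kap0.
move: kap0; rewrite le_eqVlt => /predU1P[k0|k0].
  rewrite -k0 mule0 inve0.
  have [bE|bN] := eqVneq b 0.
    right; exists 0 => //; rewrite bE mul0e; split => // v /bcone.
    by rewrite bE ltxx.
  by left; rewrite gt0_muley// lte_fin lt_def bN.
right; exists (b / (n%:R * k)); first by rewrite divr_ge0// mulr_ge0// ltW.
rewrite -EFinM inver gt_eqF ?mulr_gt0//; split=> // v /kap_le; rewrite lee_fin => kE.
have -> : b / (n%:R * k) * n%:R * E v = b * (E v / k).
  by field; rewrite !gt_eqF.
by rewrite -[leLHS]mulr1 ler_wpM2l// ler_pdivlMr// mul1r.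
Qed.

(** The inequality between arithmetic and geometric means. *)
Lemma le_add_of_sqr_le (w X Y : R) : 0 <= w -> 0 <= X -> 0 <= Y ->
  w ^+ 2 <= 4 * (X * Y) -> w <= X + Y.
Proof.
move=> w0 X0 Y0 h.
rewrite -(@ler_pXn2r _ 2)// ?nnegrE ?addr_ge0// (le_trans h)//.
have := sqr_ge0 (X - Y); rewrite !expr2; lra.
Qed.

Context {T : Type} {K n : nat}.
Variables (f : 'I_K -> T -> R) (f0 : T -> R) (x : 'I_n -> T).
Variables (M V s L : R).
Hypothesis n0 : (0 < n)%N.
Hypothesis M0 : 0 < M.
Hypothesis V0 : 0 < V.
Hypothesis s0 : 0 <= s.
Hypothesis L0 : 0 < L.
Hypothesis sL : n%:R * s ^+ 2 = L.

Let n0' : 0 < n%:R :> R. Proof. by rewrite ltr0n. Qed.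

Lemma cone_card_gt0 (J : {set 'I_K}) (c : R) (v : 'cV[R]_K) :
  l1norm (restr (~: J) v) < c * l1norm (restr J v) -> (0 < #|J|)%N.
Proof.
move=> h; rewrite card_gt0; apply/eqP => J0; move: h.
rewrite J0 (_ : l1norm (restr finset.set0 v) = 0).
  by rewrite mulr0 ltNge l1norm_ge0.
by rewrite l1norm_restr big_set0.
Qed.

(** The linear term [zeta * l1norm (pi' - pi)], with [zeta = 8 V ^ 3 s], is
    absorbed. Let [p] be the mass of [pi] outside [J] and
    [a = 3 |v_J| - |v_(~: J)|] with [v = pi' - pi]; then [|v| <= a + 4 p]. If
    [a <= 0] the first term of the bound suffices; otherwise [v] lies in the
    cone, which bounds [zeta * a] by the quadratic term and [tau]. *)
Lemma kappa_oracle (J : {set 'I_K}) (pi pi' : 'cV[R]_K) :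
  simplex pi -> simplex pi' ->
  let B := ((288 * M ^+ 2 * V ^+ 6 * #|J|%:R * L)%:E /
     (n%:R%:E * kappa (gram f f0 x) J 3))%E in
  B = +oo%E \/ exists2 tau, 0 <= tau & B = tau%:E /\
    8 * V ^+ 3 * s * l1norm (pi' - pi) <=
    gram_form f f0 x (pi' - pi) / (2 * M ^+ 2) +
    32 * V ^+ 3 * s * l1norm (restr (~: J) pi) + tau.
Proof.
move=> spi spi' B.
have C0 : 0 < 288 * M ^+ 2 * V ^+ 6 by rewrite !mulr_gt0// exprn_gt0.
have b0 : 0 <= 288 * M ^+ 2 * V ^+ 6 * #|J|%:R * L.
  by rewrite !mulr_ge0// ltW.
set cone := [set v : 'cV[R]_K | l1norm (restr (~: J) v) < 3 * l1norm (restr J v)].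
have := @div_ereal_inf_cases _ cone (fun v => 3 ^+ 2 * #|J|%:R *
  l2norm (sqrtmx (gram f f0 x) *m v) ^+ 2 /
  (3 * l1norm (restr J v) - l1norm (restr (~: J) v)) ^+ 2) _ n n0 b0.
case.
- move=> v _; apply: divr_ge0; last exact: sqr_ge0.
  apply: mulr_ge0; last exact: sqr_ge0.
  by apply: mulr_ge0 => //; exact: sqr_ge0.
- by move=> v /cone_card_gt0 J0; rewrite !mulr_gt0// ltr0n.
- by left.
move=> [tau tau0 [BE Hc]]; right; exists tau => //; split=> //.
set v := pi' - pi in Hc *; set A := gram_form f f0 x v.
have A0 : 0 <= A by exact: gram_form_ge0.
have vs : l1norm v = l1norm (restr J v) + l1norm (restr (~: J) v) by exact: l1norm_split.
have vc := simplex_difference_cone J _ _ spi spi'; rewrite -/v in vc.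
set p := l1norm (restr (~: J) pi) in vc *.
set vJ := l1norm (restr J v) in vs vc *.
set vJc := l1norm (restr (~: J) v) in vs vc *.
have z0 : 0 <= V ^+ 3 * s by rewrite mulr_ge0// exprn_ge0// ltW.
have Y0 : 0 <= A / (2 * M ^+ 2) by rewrite divr_ge0// mulr_ge0// sqr_ge0.
have [a0|a0] := leP (3 * vJ - vJc) 0.
  have : l1norm v <= 4 * p by lra.
  move=> /(ler_wpM2l z0); lra.
have cv : cone v by rewrite /cone/= -subr_gt0.
have J0 : 0 < #|J|%:R :> R by rewrite ltr0n (cone_card_gt0 _ _ _ cv).
have := Hc v cv; rewrite -/vJ -/vJc.
set a := 3 * vJ - vJc in a0 *.
have l2A := l2norm_sqrtmx_le f f0 x v; rewrite -/A in l2A.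
set l2 := l2norm _ ^+ 2 in l2A *.
rewrite -sL => H.
have H1 : 32 * M ^+ 2 * V ^+ 6 * s ^+ 2 * a ^+ 2 <= tau * A.
  apply: (@le_trans _ _ (tau * l2)); last by rewrite ler_wpM2l.
  have c0 : 0 < 9 * #|J|%:R * n%:R / a ^+ 2 by rewrite divr_gt0 ?exprn_gt0// !mulr_gt0.
  rewrite -(ler_pM2l c0); move: H.
  congr (_ <= _); field; by rewrite gt_eqF.
have H2 : 8 * V ^+ 3 * s * a <= tau + A / (2 * M ^+ 2).
  apply: le_add_of_sqr_le => //.
    by rewrite mulr_ge0 ?(ltW a0)// -mulrA mulr_ge0.
  have M20 : 0 < M ^+ 2 by exact: exprn_gt0.
  rewrite -(ler_pM2l M20).
  have -> : M ^+ 2 * (8 * V ^+ 3 * s * a) ^+ 2 =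
     2 * (32 * M ^+ 2 * V ^+ 6 * s ^+ 2 * a ^+ 2) by ring.
  have -> : M ^+ 2 * (4 * (tau * (A / (2 * M ^+ 2)))) = 2 * (tau * A).
    by field; rewrite gt_eqF.
  by rewrite ler_pM2l.
have : l1norm v <= a + 4 * p by rewrite /a; lra.
move=> /(ler_wpM2l z0); lra.
Qed.

(** If [pi] is supported in [J], then [|v_(~: J)| <= |v_J|] and
    [|v| <= 2 |v_J|] for [v = pi' - pi]. As the first inequality may be an
    equality while the cone is open, the compatibility inequality is applied to
    [v + e v_J], with [e] tending to 0. *)
Lemma kappa_bar_oracle (J : {set 'I_K}) (pi pi' : 'cV[R]_K) :
  simplex pi -> restr (~: J) pi = 0 -> simplex pi' ->
  let B := ((128 * M ^+ 2 * V ^+ 6 * #|J|%:R * L)%:E /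
     (n%:R%:E * kappa_bar (gram f f0 x) J 1))%E in
  B = +oo%E \/ exists2 tau, 0 <= tau & B = tau%:E /\
    8 * V ^+ 3 * s * l1norm (pi' - pi) <=
    gram_form f f0 x (pi' - pi) / (2 * M ^+ 2) + tau.
Proof.
move=> spi piJ spi' B.
have C0 : 0 < 128 * M ^+ 2 * V ^+ 6 by rewrite !mulr_gt0// exprn_gt0.
have b0 : 0 <= 128 * M ^+ 2 * V ^+ 6 * #|J|%:R * L.
  by rewrite !mulr_ge0// ltW.
set cone := [set v : 'cV[R]_K | l1norm (restr (~: J) v) < 1 * l1norm (restr J v)].
have := @div_ereal_inf_cases _ cone (fun v => #|J|%:R *
  l2norm (sqrtmx (gram f f0 x) *m v) ^+ 2 / l1norm (restr J v) ^+ 2) _ n n0 b0.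
case.
- move=> v _; apply: divr_ge0; last exact: sqr_ge0.
  by apply: mulr_ge0 => //; exact: sqr_ge0.
- by move=> v /cone_card_gt0 J0; rewrite !mulr_gt0// ltr0n.
- by left.
move=> [tau tau0 [BE Hc]]; right; exists tau => //; split=> //.
set v := pi' - pi; set A := gram_form f f0 x v.
have A0 : 0 <= A by exact: gram_form_ge0.
have vs : l1norm v = l1norm (restr J v) + l1norm (restr (~: J) v) by exact: l1norm_split.
have vc := simplex_difference_cone J _ _ spi spi'; rewrite -/v piJ in vc.
have l10 : l1norm (0 : 'cV[R]_K) = 0.
  by rewrite /l1norm big1// => j _; rewrite mxE normr0.
rewrite l10 mulr0 addr0 in vc.
set vJ := l1norm (restr J v) in vs vc.
set vJc := l1norm (restr (~: J) v) in vs vc.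
have vJ0 : 0 <= vJ by exact: l1norm_ge0.
have z0 : 0 <= V ^+ 3 * s by rewrite mulr_ge0// exprn_ge0// ltW.
have Y0 : 0 <= A / (2 * M ^+ 2) by rewrite divr_ge0// mulr_ge0// sqr_ge0.
have v2 : l1norm v <= 2 * vJ by lra.
suff H1 : 2 * M ^+ 2 * (8 * V ^+ 3 * s) ^+ 2 * vJ ^+ 2 <= tau * A.
  have H2 : 2 * (8 * V ^+ 3 * s) * vJ <= tau + A / (2 * M ^+ 2).
    apply: le_add_of_sqr_le => //.
      by rewrite mulr_ge0// mulr_ge0// -mulrA mulr_ge0.
    have M20 : 0 < M ^+ 2 by exact: exprn_gt0.
    rewrite -(ler_pM2l M20).
    have -> : M ^+ 2 * (2 * (8 * V ^+ 3 * s) * vJ) ^+ 2 =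
       2 * (2 * M ^+ 2 * (8 * V ^+ 3 * s) ^+ 2 * vJ ^+ 2) by ring.
    have -> : M ^+ 2 * (4 * (tau * (A / (2 * M ^+ 2)))) = 2 * (tau * A).
      by field; rewrite gt_eqF.
    by rewrite ler_pM2l.
  move: v2 => /(ler_wpM2l z0); lra.
have [vJE|vJN] := eqVneq vJ 0.
  by rewrite vJE expr0n mulr0 mulr_ge0.
have vJ0' : 0 < vJ by rewrite lt_def vJN.
have [C _ HC] := gram_form_perturb f f0 x v (restr J v).
rewrite -subr_le0; apply: (@le0_of_le_scaled _ _ (tau * C)) => e e01.
have /andP[e0 e1] := e01.
pose ve := v + e *: restr J v.
have veJ : l1norm (restr J ve) = (1 + e) * vJ.
  rewrite /vJ !l1norm_restr mulr_sumr; apply: eq_bigr => j jJ.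
  have -> : ve j 0 = (1 + e) * v j 0 by rewrite !mxE jJ; ring.
  by rewrite normrM ger0_norm// addr_ge0// ltW.
have veJc : l1norm (restr (~: J) ve) = vJc.
  rewrite /vJc !l1norm_restr; apply: eq_bigr => j; rewrite inE => jJ.
  by rewrite !mxE (negbTE jJ) mulr0 addr0.
have evJ : 0 < e * vJ by rewrite mulr_gt0.
have cve : cone ve by rewrite /cone/= veJ veJc; lra.
have J0 : 0 < #|J|%:R :> R by rewrite ltr0n (cone_card_gt0 _ _ _ cve).
have := Hc ve cve; rewrite veJ.
have l2A := l2norm_sqrtmx_le f f0 x ve.
set l2 := l2norm _ ^+ 2 in l2A *.
rewrite -sL => H.
have e10 : 0 < 1 + e by lra.
have H1 : 2 * M ^+ 2 * (8 * V ^+ 3 * s) ^+ 2 * ((1 + e) * vJ) ^+ 2 <= tau * l2.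
  have c0 : 0 < #|J|%:R * n%:R / ((1 + e) * vJ) ^+ 2.
    by rewrite divr_gt0 ?exprn_gt0 ?mulr_gt0.
  rewrite -(ler_pM2l c0); move: H.
  by congr (_ <= _); field; rewrite vJN gt_eqF.
have H2 : tau * l2 <= tau * (A + e * C).
  by rewrite ler_wpM2l// (le_trans l2A)// HC.
have D0 : 0 <= 2 * M ^+ 2 * (8 * V ^+ 3 * s) ^+ 2.
  by rewrite mulr_ge0 ?sqr_ge0// mulr_ge0// sqr_ge0.
have H3 : vJ ^+ 2 <= ((1 + e) * vJ) ^+ 2.
  rewrite exprMn -[leLHS]mul1r ler_wpM2r ?sqr_ge0// exprn_ege1//; lra.
have := ler_wpM2l D0 H3; lra.
Qed.

End CompatibilityTerm.

(** * Oracle inequalities *)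

Lemma geometric_lt {R : realType} (r eps : R) : 0 <= r -> r < 1 -> 0 < eps ->
  exists N, r ^+ N <= eps.
Proof.
move=> r0 r1 e0.
have /cvgrPdist_le /(_ _ e0) [N _ /(_ N (leqnn N))] : r ^+ N @[N --> \oo] --> 0.
  by apply: cvg_expr; rewrite ger0_norm.
by rewrite /= sub0r normrN ger0_norm ?exprn_ge0// => ?; exists N.
Qed.

Section SameLaw.
Context {d d' : measure_display} {Omega : measurableType d}
  {T : measurableType d'} {R : realType} {P : probability Omega R}.

Lemma Rintegral_same_law (X Y : {RV P >-> T}) (h : T -> R) :
  (forall A, measurable A -> distribution P X A = distribution P Y A) ->
  bounded_measurable h -> \int[P]_w h (X w) = \int[distribution P Y]_y h y.
Proof.
move=> XY bh; have mX : measurable_fun [set: Omega] X by exact: measurable_funP.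
rewrite /Rintegral; congr fine.
have mh : measurable_fun [set: T] (EFin \o h) by exact/measurable_EFinP/bh.1.
rewrite [RHS](eq_measure_integral (distribution P X)); last first.
  by move=> A mA _; apply/esym/XY.
rewrite (integral_distribution mh)//.
exact: (bounded_measurable_integrable P _ (bounded_measurable_comp X h mX bh)).
Qed.

End SameLaw.

Theorem theorem2p1 (R : realType)
  (d : measure_display) (Omega : measurableType d) (P : probability Omega R)
  (d' : measure_display) (T : measurableType d')
  (nu : {measure set T -> \bar R})
  (K : nat) (hK : (4 <= K)%N)
  (f : 'I_K -> T -> R) (hf : forall k, is_density nu (f k))
  (m M : R) (hm : 0 < m) (hmM : m <= M)
  (hbound : forall k x, m <= f k x <= M)
  (f0 : T -> R)
  (fstar : T -> R) (hfstar : is_density nu fstar)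
  (n : nat) (hn : (0 < n)%N)
  (X : 'I_n -> {RV P >-> T})
  (hindep : mutually_independent X)
  (hdens : forall i, has_density (X i) nu fstar)
  (pihat : Omega -> 'cV[R]_K)
  (hpihat : forall w, is_mle f (fun i => X i w) (pihat w)) :
  exists c1 c2 c3 : R,
    [/\ 0 < c1 <= 32 * (M / m) ^+ 3,
        0 < c2 <= 288 * M ^+ 2 * (M / m) ^+ 6,
        0 < c3 <= 128 * M ^+ 2 * (M / m) ^+ 6 &
        forall delta : R, 0 < delta < 2^-1 ->
          exists E : set Omega,
            [/\ measurable E,
                ((1 - delta)%:E <= P E)%E &
                forall w, E w ->
                  (KL nu fstar (mixture f (pihat w)) <=
                     oracle_bound nu fstar f n
                       (gram f f0 (fun i => X i w)) delta c1 c2)%E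
                  /\
                  (KL nu fstar (mixture f (pihat w)) <=
                     sparse_oracle_bound nu fstar f n
                       (gram f f0 (fun i => X i w)) delta c3)%E]].
Proof.
have M0 : 0 < M by exact: lt_le_trans hmM.
set V := M / m.
have V0 : 0 < V by rewrite divr_gt0.
have V1 : 1 <= V by rewrite ler_pdivlMr// mul1r.
have nR0 : 0 < n%:R :> R by rewrite ltr0n.
have KR4 : 4 <= K%:R :> R by rewrite (ler_nat R 4).
have mf k : measurable_fun [set: T] (f k) by have [] := hf k.
exists (32 * V ^+ 3), (288 * M ^+ 2 * V ^+ 6), (128 * M ^+ 2 * V ^+ 6); split.
- by rewrite lexx andbT mulr_gt0// exprn_gt0.
- by rewrite lexx andbT; do ?apply: mulr_gt0 => //; exact: exprn_gt0.
- by rewrite lexx andbT; do ?apply: mulr_gt0 => //; exact: exprn_gt0.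
move=> delta hd; have /andP[d0 d2] := hd.
set L := ln (K%:R / delta); set s := Num.sqrt (L / n%:R).
have L0 : 0 < L by rewrite ln_gt0// ltr_pdivlMr// mul1r; lra.
have s0 : 0 < s by rewrite sqrtr_gt0 divr_gt0.
have sL : n%:R * s ^+ 2 = L.
  by rewrite sqr_sqrtr ?divr_ge0 ?ltW//; field; rewrite gt_eqF.
pose Q : probability T R := distribution P (X (Ordinal hn)).
have lawX i h : bounded_measurable h -> \int[P]_w h (X i w) = \int[Q]_y h y.
  move=> bh; apply: Rintegral_same_law => // A mA.
  by rewrite !hdens.
have lawQ A : measurable A -> Q A = (\int[nu]_(x in A) (fstar x)%:E)%E.
  by move=> mA; exact: hdens.
have nufin : (nu [set: T] < +oo)%E.
  apply: (density_bounded_below_finite nu (f (Ordinal (ltn_trans (ltn0Sn 2) hK))) m) => // x.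
  by case/andP: (hbound (Ordinal (ltn_trans (ltn0Sn 2) hK)) x).
have r0 : 0 <= 1 - m / M by rewrite subr_ge0 ler_pdivrMr// mul1r.
have r1 : 1 - m / M < 1 by rewrite gtrBl divr_gt0.
(* The order of the Taylor expansion is chosen so that its remainder is
   negligible compared with s. *)
have [N rN] : exists N, (1 - m / M) ^+ N <= 2 * V ^+ 2 * s.
  by apply: geometric_lt => //; do ?apply: mulr_gt0 => //; exact: exprn_gt0.
have [E [mE PE HE]] := monomial_deviation_event n X Q hn hindep lawX K f m M
  hK hm hmM hbound mf delta N hd.
exists E; split=> // w /HE {}HE.
pose x i := X i w.
have mle := hpihat w; have sph := mle.1.
have mixb p y : simplex p -> m <= mixture f p y <= M by exact: mixture_bound.
have mmix p : measurable_fun [set: T] (mixture f p).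
  exact: (bounded_measurable_mixture K f m M hm hbound mf p).1.
have tau0 : 0 <= 4 * s by rewrite mulr_ge0// ltW.
(* The basic inequality: excess risk plus curvature is at most the deviation. *)
have key pi : simplex pi -> exists2 D : R,
    (KL nu fstar (mixture f (pihat w)) <= KL nu fstar (mixture f pi) + D%:E)%E &
    D + gram_form f f0 x (pihat w - pi) / (2 * M ^+ 2) <=
      8 * V ^+ 3 * s * l1norm (pihat w - pi).
  move=> spi.
  have bl p : simplex p -> bounded_measurable (fun y : T => ln (mixture f p y)).
    by move=> sp; apply: (bounded_measurable_ln_mixture K f m M).
  have bd : bounded_measurable
      (fun y => ln (mixture f pi y) - ln (mixture f (pihat w) y)).
    by apply: bounded_measurableB; exact: bl.
  exists (\int[Q]_y (ln (mixture f pi y) - ln (mixture f (pihat w) y))).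
    apply: (KL_le_add nu fstar hfstar m M hm hmM nufin Q lawQ) => //.
    - by move=> y; exact: mixb.
    - by move=> y; exact: mixb.
  have dev := log_mixture_deviation K f m M hm hmM hbound mf n x Q hn N (4 * s)
    tau0 HE (pihat w) pi sph spi.
  have l1C : l1norm (pi - pihat w) = l1norm (pihat w - pi).
    by apply: eq_bigr => j _; rewrite !mxE distrC.
  rewrite l1C in dev.
  have gap := mle_quadratic_gap f m M x hm hmM hbound hn f0 _ _ mle spi.
  (* zeta = 8 V ^ 3 s bounds the sum of both deviation terms, as 1 <= V. *)
  have zle : 4 * s * V ^+ 2 + 2 * (1 - m / M) ^+ N * V <= 8 * V ^+ 3 * s.
    have h1 : s * V ^+ 2 * 1 <= s * V ^+ 2 * V.
      by rewrite ler_wpM2l// mulr_ge0 ?ltW// exprn_gt0.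
    have h2 : (1 - m / M) ^+ N * V <= 2 * V ^+ 2 * s * V by rewrite ler_wpM2r// ltW.
    have -> : V ^+ 3 = V ^+ 2 * V by rewrite exprSr.
    lra.
  have := ler_wpM2r (l1norm_ge0 (pihat w - pi)) zle.
  move: dev; rewrite ler_norml => /andP[dev _].
  move: gap dev; rewrite /empirical_deviation -/V !sumrB !mulrBr; lra.
have KLN p : simplex p -> KL nu fstar (mixture f p) != -oo%E.
  move=> sp; rewrite -ltNye.
  apply: (KL_gtNy nu fstar hfstar m M hm hmM nufin) => // y; exact: mixb.
split.
- apply: le_ereal_inf_tmp => _ [J _ [pi spi <-]].
  have [D KLD HD] := key pi spi.
  have [->|[tau tau_ge0 [-> Htau]]] := kappa_oracle f f0 x M V s L hn M0 V0
    (ltW s0) L0 sL J pi (pihat w) spi sph.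
    by rewrite addey ?leey// adde_eq_ninfty negb_or KLN.
  rewrite (le_trans KLD)// -addeA leeD2l// -EFinD lee_fin -/s; lra.
- apply: le_ereal_inf_tmp => _ [J _ <-].
  apply: le_ereal_inf_tmp => _ [pi [spi piJ] <-].
  have [D KLD HD] := key pi spi.
  have [->|[tau tau_ge0 [-> Htau]]] := kappa_bar_oracle f f0 x M V s L hn M0 V0
    (ltW s0) L0 sL J pi (pihat w) spi piJ sph.
    by rewrite addey ?leey// KLN.
  rewrite (le_trans KLD)// leeD2l// lee_fin; lra.
Qed.
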